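(* There exist absolute constants $C, c \in (0,\infty)$ such that the following holds for every $p \in (1,\infty)$, with $q := \frac{p}{p-1}$. For $A \in (0,\infty)$ set $$B_p(A) := \begin{cases} 1 & \text{if } A \le q e^{-q},\\ \dfrac{q}{\log(q/A)} & \text{if } q e^{-q} \le A \le q e^{-1},\\ e A & \text{if } A \ge q e^{-1}. \end{cases}$$ (i) (Upper bound.) For all $\varepsilon \in (0,\frac12]$, $d \in \mathbb{N}$ and every $(\varepsilon,d)$-configuration $\mathcal{S}_0$ in $\mathbb{T}^\omega$, with $A_p(\mathcal{S}_0) := \varepsilon d^{1/p}$, one has $$\|\mathcal{M}_{\mathcal{S}_0}\|_{L^p \to L^{p,\infty}} \le C\, B_p(A_p(\mathcal{S}_0)).$$ (ii) (Sharpness.) For every $A \in (0,\infty)$ there exist $\varepsilon \in (0,\frac12]$, $d \in \mathbb{N}$ with $\varepsilon d^{1/p} = A$ and an $(\varepsilon,d)$-configuration $\mathcal{S}_0$ such that $$\|\mathcal{M}_{\mathcal{S}_0}\|_{L^p \to L^{p,\infty}} \ge c\, B_p(A).$$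
   Context: $\mathbb{N}=\{1,2,\dots\}$; $\log$ is the natural logarithm. $\mathbb{T}^\omega$ is the product of countably many copies of $\mathbb{T}=\mathbb{R}/\mathbb{Z}$ (identified with $[0,1)$), with normalized Haar measure $dx$; $|E|$ denotes the measure of $E$. $L^p = L^p(\mathbb{T}^\omega)$. Sets $V_m$ and subgroups $H_m$, $m\in\mathbb{N}$. To each $m$ assign a finite list of positive integers (exponents) $(a_1,\dots,a_N)$ as follows. If $m=1$ the list is $(1)$. If $m=n^2+j$ with $n\ge 1$ and $1\le j\le n$, then $N=n+1$, $a_1=\dots=a_n=n$, $a_{n+1}=j$. If $m=n^2+n+j$ with $n\ge1$ and $1\le j\le n+1$, then $N=n+1$, $a_i=n+1$ for $i\le j$ and $a_i=n$ for $j<i\le n+1$. Put $V_m=\prod_{i=1}^N(0,2^{-a_i})\times\mathbb{T}\times\mathbb{T}\times\cdots$ and $H_m=\prod_{i=1}^N\{0,2^{-a_i},\dots,(2^{a_i}-1)2^{-a_i}\}\times\{0\}\times\{0\}\times\cdots$. The first $N$ coordinates are called the nonfree coordinates of $V_m$. (For example $V_2=(0,\frac12)^2\times\mathbb{T}\times\cdots$, $V_3=(0,\frac14)\times(0,\frac12)\times\mathbb{T}\times\cdots$, $V_4=(0,\frac14)^2\times\mathbb{T}\times\cdots$, $V_5=(0,\frac14)^2\times(0,\frac12)\times\mathbb{T}\times\cdots$.) Let $\mathcal{R}_0=\{t+V_m: m\in\mathbb{N},\ t\in H_m\}$. $(\varepsilon,d)$-configuration. Let $\varepsilon\in(0,\frac12]$,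 $d\in\mathbb{N}$, and let $Q=t+V_m\in\mathcal{R}_0$ ($t\in H_m$) with $m$ so large that $V_m$ has at least $d$ nonfree coordinates. For $k\in\{1,\dots,d\}$ let $Q_k=T_k+Q$, where $T_k\in\mathbb{T}^\omega$ has $k$-th coordinate $(1-\varepsilon)|\pi_k(Q)|$ and all other coordinates $0$; here $\pi_k$ is the projection onto the $k$-th coordinate and $|\pi_k(Q)|$ is the length of $\pi_k(Q)\subset\mathbb{T}$. Then $\{Q_1,\dots,Q_d\}$ is called an $(\varepsilon,d)$-configuration around $Q$; an $(\varepsilon,d)$-configuration is an $(\varepsilon,d)$-configuration around some such $Q$. (The set $Q$ itself is not a member of the configuration.) Maximal operator. For a collection $\mathcal{B}$ of measurable sets of positive measure, $\mathcal{M}_{\mathcal{B}}f(x)=\sup_{B\in\mathcal{B},\,x\in B}\frac1{|B|}\int_B|f|\,dx$, with $\mathcal{M}_{\mathcal{B}}f(x)=0$ if no $B\in\mathcal{B}$ contains $x$. $\|\mathcal{M}_{\mathcal{B}}\|_{L^p\to L^{p,\infty}}$ is the smallest $K\in[0,\infty]$ such that $\lambda\,|\{\mathcal{M}_{\mathcal{B}}f>\lambda\}|^{1/p}\le K\|f\|_{L^p}$ for all $f\in L^p$ and $\lambda>0$. *)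

(* Defs.v *)
From HB Require Import structures.
From mathcomp Require Import all_boot all_order all_algebra.
From mathcomp Require Import all_classical all_reals all_analysis.
From mathcomp Require Import zify.

Set Implicit Arguments.
Unset Strict Implicit.
Unset Printing Implicit Defensive.

Import Order.TTheory GRing.Theory Num.Theory.
Import numFieldNormedType.Exports.

Local Open Scope classical_set_scope.
Local Open Scope ring_scope.

(* R/Z, each class being represented by its element of [0, 1). *)
Record torus (R : realType) := Torus {
  torus_rep : R ;
  torus_repP : 0 <= torus_rep < 1 }.

HB.instance Definition _ (R : realType) := [isSub for @torus_rep R].
HB.instance Definition _ (R : realType) := [Choice of torus R by <:].

Lemma torus_class_subproof (R : realType) (x : R) :
  0 <= x - (Num.floor x)%:~R < 1.
Proof.
have /andP[h1 h2] := floor_itv x.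
by rewrite subr_ge0 h1 ltrBlDl -[1]/(1%:~R) -intrD.
Qed.

Definition torus_class (R : realType) (x : R) : torus R :=
  Torus (torus_class_subproof x).

Section torus_zmodType.
Variable R : realType.
Implicit Types (x y z : torus R) (r s : R).

Let add x y := torus_class (torus_rep x + torus_rep y).
Let opp x := torus_class (- torus_rep x).

Lemma torus_classDint r (k : int) :
  torus_class (r + k%:~R) = torus_class r.
Proof.
apply/val_inj => /=.
by rewrite floorDrz ?intr_int// rmorphD/= intrKfloor opprD addrACA subrr addr0.
Qed.

Lemma torus_repK : cancel (@torus_rep R) (@torus_class R).
Proof.
move=> x; apply/val_inj => /=; rewrite (@floor_def _ _ 0) ?subr0//.
by rewrite add0r; exact: torus_repP.
Qed.

Let addE r s : add (torus_class r) (torus_class s) = torus_class (r + s).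
Proof.
rewrite /add /= addrACA -opprD -intrD -mulrNz.
by rewrite torus_classDint.
Qed.

Let addA : associative add.
Proof. by move=> x y z; rewrite -[x]torus_repK -[y]torus_repK -[z]torus_repK !addE addrA. Qed.

Let addC : commutative add.
Proof. by move=> x y; rewrite /add addrC. Qed.

Let add0 : left_id (torus_class 0) add.
Proof. by move=> x; rewrite -[x]torus_repK addE add0r. Qed.

Let addN : left_inverse (torus_class 0) opp add.
Proof. by move=> x; rewrite /opp -[X in add _ X]torus_repK addE addNr. Qed.

HB.instance Definition _ := GRing.isZmodule.Build (torus R) addA addC add0 addN.

Lemma torus_classD r s : torus_class (r + s) = torus_class r + torus_class s.
Proof. by rewrite -addE. Qed.

End torus_zmodType.

HB.instance Definition _ (R : realType) :=
  isPointed.Build (torus R) (torus_class 0).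


(* Coordinates are indexed from 0: [x i] is the (i+1)-st coordinate of x. *)
Definition torusw (R : realType) := nat -> torus R.

HB.instance Definition _ (R : realType) := GRing.Zmodule.on (torusw R).
HB.instance Definition _ (R : realType) := Pointed.on (torusw R).

(* The product sigma-algebra; it is also the Borel sigma-algebra of the
   (second countable) product topology. *)
Definition torusw_cylinder (R : realType) : set (set (torusw R)) :=
  [set A | exists i (B : set R), measurable B /\
    A = [set x | B (torus_rep (x i))]].

Definition torusw_display : measure_display.
Proof. exact. Qed.

HB.instance Definition _ (R : realType) :=
  @isMeasurable.Build torusw_display (torusw R) <<s @torusw_cylinder R >>
    (@sigma_algebra0 _ _ _) (@sigma_algebraC _ _)
    (@sigma_algebra_bigcup _ _ _).

Definition translate (R : realType) (t : torusw R) (A : set (torusw R)) :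
  set (torusw R) := [set t + x | x in A].

Definition haar (R : realType) (mu : probability (torusw R) R) :=
  forall (t : torusw R) (A : set (torusw R)),
    measurable A -> mu (translate t A) = mu A.

(* The length of a subset of R/Z, seen as a subset of [0, 1). *)
Definition torus_length (R : realType) (A : set (torus R)) : R :=
  fine (lebesgue_measure [set torus_rep x | x in A]).

(* The list attached to m > 0: here n ^ 2 < m <= (n + 1) ^ 2, and n = 0 iff
   m = 1. *)
Definition exponents (m : nat) : seq nat :=
  let n := \max_(i < m | (i ^ 2 < m)%N) i in
  let j := (m - n ^ 2)%N in
  if n == 0%N then [:: 1%N]
  else if (j <= n)%N then rcons (nseq n n) j
  else nseq (j - n) n.+1 ++ nseq (n.+1 - (j - n)) n.

Lemma exponents1 : exponents 1 = [:: 1%N].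
Proof. by rewrite /exponents big_mkcond big_ord1. Qed.

Lemma exponents_root (m n : nat) :
  (n ^ 2 < m)%N -> (m <= n.+1 ^ 2)%N -> \max_(i < m | (i ^ 2 < m)%N) i = n.
Proof.
move=> nm mn; apply/eqP; rewrite eqn_leq; apply/andP; split.
  apply/bigmax_leqP => i im; rewrite -ltnS -(@ltn_exp2r _ _ 2)//.
  exact: leq_trans mn.
have nltm : (n < m)%N.
  by apply: leq_ltn_trans nm; case: n {mn} => // n; rewrite expnS leq_pmulr.
by rewrite (@leq_bigmax_cond _ _ _ (Ordinal nltm)).
Qed.

Lemma exponents_low (n j : nat) : (1 <= n)%N -> (1 <= j <= n)%N ->
  exponents (n ^ 2 + j) = rcons (nseq n n) j.
Proof.
move=> n1 /andP[j1 jn]; rewrite /exponents (@exponents_root _ n).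
- by rewrite addKn jn gtn_eqF.
- lia.
- by rewrite -(addn1 n) sqrnD; lia.
Qed.

Lemma exponents_high (n j : nat) : (1 <= n)%N -> (1 <= j <= n.+1)%N ->
  exponents (n ^ 2 + n + j) = nseq j n.+1 ++ nseq (n.+1 - j) n.
Proof.
move=> n1 /andP[j1 jn]; rewrite /exponents (@exponents_root _ n).
- by rewrite -addnA addKn addKn gtn_eqF// ifF//; lia.
- lia.
- by rewrite -(addn1 n) sqrnD; lia.
Qed.

Section configurations.
Variable R : realType.

Definition V (m : nat) : set (torusw R) :=
  let a := exponents m in
  [set x | forall i, (i < size a)%N ->
    0 < torus_rep (x i) < 2%:R ^- nth 0%N a i].

Definition H (m : nat) : set (torusw R) :=
  let a := exponents m in
  [set t | forall i, if (i < size a)%N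
    then exists2 l : nat, (l < 2 ^ nth 0%N a i)%N &
      torus_rep (t i) = l%:R * 2%:R ^- nth 0%N a i
    else t i = 0].

(* [conf_shift eps Q k] is the vector T_(k+1). *)
Definition conf_shift (eps : R) (Q : set (torusw R)) (k : nat) : torusw R :=
  fun i => if i == k
    then torus_class ((1 - eps) * torus_length [set x k | x in Q])
    else 0.

Definition configuration_around (eps : R) (d : nat) (Q : set (torusw R)) :
  set (set (torusw R)) :=
  [set translate (conf_shift eps Q k) Q | k in [set k | (k < d)%N]].

Definition is_configuration (eps : R) (d : nat) (S : set (set (torusw R))) :=
  exists (m : nat) (t : torusw R),
    [/\ (1 <= m)%N, H m t, (d <= size (exponents m))%N &
        S = configuration_around eps d (translate t (V m))].

End configurations.

Section maximal_operator.
Context d (T : measurableType d) (R : realType).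
Variable mu : {measure set T -> \bar R}.

Definition maximal (B : set (set T)) (f : T -> R) (x : T) : \bar R :=
  if `[< exists2 Q, B Q & Q x >] then
    ereal_sup [set ((fine (mu Q))^-1)%:E * \int[mu]_(y in Q) `|f y|%:E
              | Q in [set Q | B Q /\ Q x]]%E
  else 0%E.

Definition weak_type_norm (p : R) (B : set (set T)) : \bar R :=
  ereal_inf [set K : \bar R | (0 <= K)%E /\
    forall f : T -> R, f \in Lfun mu p%:E -> forall l : R, 0 < l ->
      (l%:E * mu [set x | l%:E < maximal B f x] `^ p^-1
        <= K * 'N[mu]_p%:E[EFin \o f])%E].

End maximal_operator.

Definition Bp (R : realType) (p A : R) : R :=
  let q := p / (p - 1) in
  if A <= q * expR (- q) then 1
  else if A <= q * expR (- 1) then q / ln (q / A)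
  else expR 1 * A.

(* Main.v *)
Require Import Defs.
From mathcomp Require Import all_boot all_order all_algebra.
From mathcomp Require Import all_classical all_reals all_analysis.
From mathcomp Require Import measurable_realfun ring lra zify.

Set Implicit Arguments.
Unset Strict Implicit.
Unset Printing Implicit Defensive.

Import Order.TTheory GRing.Theory Num.Theory.
Import numFieldNormedType.Exports.

Local Open Scope classical_set_scope.
Local Open Scope ring_scope.

(* In the configuration around Q, the sets Q_k \ Q are pairwise disjoint, while
   under the normalized Haar measure on Q the traces Q_k /\ Q are independent
   events of probability eps.  Hence, with N the number of the n sets Q_k
   containing a point, N is at most 1 off Q and binomial with parameters (n, eps)
   on Q.

   Upper bound: if the averages of |f| over n of the sets exceed l, then
   l n |Q| < int |f| N <= |f|_p |N|_q by Hoelder, and the binomial moment is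
   estimated from its exponential moment through x^q <= (q/(e s))^q e^(s x), with
   s chosen according to the position of A = eps d^(1/p) relative to q/e and of
   n^(1/q) relative to (q/A)^(1/2).

   Lower bound: the indicator functions of some Q_k, of Q, and of
   {x in Q | N x = r} are test functions for the three regimes of B_p.  In the
   middle regime d is about e^q and r about q/log(q/A); then P(N = r)^(1/q) is
   bounded below by an absolute constant. *)

(** * Real estimates *)

(** Division-free form of (d/r)^r <= C(d,r). In the inductive step the absorption identity leaves
    (d+1)^r <= C(d,r) (r+1)^r, and r <= d gives (d+1)/d <= (r+1)/r. *)
Lemma leq_exp_bin d r : (r <= d)%N -> (d ^ r <= 'C(d, r) * r ^ r)%N.
Proof.
elim: r d => [|r IHr] [|d]//; rewrite ltnS => rd.
rewrite [in leqLHS]expnS [in leqRHS]expnS mulnA [(_ * r.+1)%N]mulnC.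
rewrite -mul_bin_diag -mulnA leq_pmul2l//.
have [->|r0] := posnP r; first by rewrite bin0 !expn0.
have rr0 : (0 < r ^ r)%N by rewrite expn_gt0 r0.
rewrite -(leq_pmul2r rr0) -[leqRHS]mulnAC -expnMn.
apply: (@leq_trans (d ^ r * r.+1 ^ r)).
  rewrite -expnMn; case: r r0 rd {IHr rr0} => // r _ rd.
  by rewrite leq_exp2r//; lia.
by rewrite leq_mul2r IHr ?orbT.
Qed.

Section constants.
Context {R : realType}.
Implicit Types p q A D L : R.

Lemma conjugate_gt1 p : 1 < p -> 1 < p / (p - 1).
Proof. by move=> p1; rewrite ltr_pdivlMr; lra. Qed.

Lemma conjugate_inv p : 1 < p -> p^-1 + (p / (p - 1))^-1 = 1.
Proof. by move=> p1; rewrite invf_div; field; lra. Qed.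

Lemma expR1_ge2 : 2 <= expR 1 :> R.
Proof. by have := expR_ge1Dx (1 : R); lra. Qed.

Lemma expR1_le4 : expR 1 <= 4 :> R.
Proof.
have h : expR 2^-1 <= 2 :> R.
  have := expR_ge1Dx (- 2^-1 : R); rewrite expRN -[in 1 + _](_ : 2^-1 = 1 - 2^-1).
    by rewrite lef_pV2 ?posrE ?expR_gt0.
  by field.
have -> : 1 = 2^-1 + 2^-1 :> R by field.
by rewrite expRD; have := expR_gt0 (2^-1 : R); nra.
Qed.

(** With L = ln (q/A), the thresholds q e^(-q) and q e^(-1) of [Bp] become L >= q and L >= 1. *)
Lemma le_ln_expR L q A : 0 < q -> 0 < A ->
  (A <= q * expR (- L)) = (L <= ln (q / A)).
Proof.
move=> q0 A0; have qA0 : 0 < q / A by rewrite divr_gt0.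
rewrite -[in RHS](expRK L) ler_ln ?posrE ?expR_gt0//.
by rewrite ler_pdivlMr// expRN ler_pdivlMr ?expR_gt0// mulrC.
Qed.

Lemma Bp_gt p A : p / (p - 1) * expR (- 1) < A -> 1 < p -> Bp p A = expR 1 * A.
Proof.
move=> qA p1; have q1 := conjugate_gt1 p1.
rewrite /Bp; case: ifPn => [Aq|_]; last by rewrite leNgt qA.
have := lt_le_trans qA Aq; rewrite ltr_pM2l ?ltr_expR; lra.
Qed.

Lemma Bp_ge1 p A : 1 < p -> 0 < A -> 1 <= Bp p A.
Proof.
move=> p1 A0; have q1 := conjugate_gt1 p1; have q0 := lt_trans ltr01 q1.
rewrite /Bp; case: ifPn => // nA1; case: ifPn => [A2|nA2].
- have L1 : 1 <= ln (p / (p - 1) / A) by rewrite -le_ln_expR.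
  rewrite ler_pdivlMr ?mul1r; last lra.
  by move: nA1; rewrite le_ln_expR// -ltNge => /ltW.
- move: nA2; rewrite -ltNge expRN ltr_pdivrMr ?expR_gt0// => qA.
  by apply/ltW/(lt_trans q1); rewrite [ltRHS]mulrC.
Qed.

(** In the first branch of [Bp] the logarithm is at least q, so the quotient is at most 1; one bound
    thus covers the two lower regimes. *)
Lemma Bp_ge_ln p A : 1 < p -> 0 < A -> A <= p / (p - 1) * expR (- 1) ->
  p / (p - 1) / ln (p / (p - 1) / A) <= Bp p A.
Proof.
move=> p1 A0 A2; have q0 := lt_trans ltr01 (conjugate_gt1 p1).
rewrite /Bp A2; case: ifPn => //; rewrite le_ln_expR// => qL.
by rewrite ler_pdivrMr ?mul1r//; apply: lt_le_trans qL.
Qed.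

(* The moment of order q of a binomial variable of mean A * D is estimated
   through x ^ q <= (q / (e s)) ^ q exp (s x); this is the choice of s. *)
Lemma exponential_moment_parameter p A D : 1 < p -> 0 < A -> 1 <= D ->
  let q := p / (p - 1) in
  exists2 s : R, 0 < s &
    q / (expR 1 * s) * expR (A * D * (expR s - 1) / q) <= 4 * D * Bp p A.
Proof.
move=> p1 A0 D1 q; have q1 : 1 < q := conjugate_gt1 p1.
have Bgt : q * expR (- 1) < A -> Bp p A = expR 1 * A by move=> qA; exact: Bp_gt.
have Bln : A <= q * expR (- 1) -> q / ln (q / A) <= Bp p A by exact: Bp_ge_ln.
have B1 : 1 <= Bp p A by exact: Bp_ge1.
move: (Bp p A) Bgt Bln B1 => B Bgt Bln B1; clearbody q.
have q0 := lt_trans ltr01 q1; have D0 := lt_le_trans ltr01 D1.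
have e2 := expR1_ge2; have e0 := expR_gt0 (1 : R); have e4 := expR1_le4.
have M0 : 0 < A * D by rewrite mulr_gt0.
(* When the mean A D is at least q/e, s = q/(e A D) <= 1 turns the prefactor into A D, and e^s - 1
   <= e s bounds the exponent by 1. *)
have large : q / expR 1 <= A * D ->
    exists2 s : R, 0 < s &
      q / (expR 1 * s) * expR (A * D * (expR s - 1) / q) <= expR 1 * (A * D).
  move=> qM; exists (q / (expR 1 * (A * D))); first by rewrite divr_gt0 ?mulr_gt0//.
  set s := q / (expR 1 * (A * D)); have s0 : 0 < s by rewrite divr_gt0 ?mulr_gt0//.
  have s1 : s <= 1.
    by rewrite ler_pdivrMr ?mulr_gt0// mul1r mulrC -ler_pdivrMr.
  have -> : q / (expR 1 * s) = A * D.
    by rewrite /s; field; rewrite ?gt_eqF.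
  rewrite mulrC ler_pM2r// ler_expR.
  have h : expR s - 1 <= expR 1 * s.
    have : expR s * (1 - s) <= 1.
      rewrite -[leRHS](mulfV (lt0r_neq0 (expR_gt0 s))) -expRN ler_pM2l ?expR_gt0//.
      by have := expR_ge1Dx (- s); lra.
    have : expR s <= expR 1 by rewrite ler_expR.
    nra.
  rewrite ler_pdivrMr// mul1r.
  apply: (@le_trans _ _ (A * D * (expR 1 * s))); first by rewrite ler_pM2l.
  by rewrite le_eqVlt; apply/orP; left; apply/eqP; rewrite /s; field; rewrite ?gt_eqF.
have [Aq|Aq] := ltP (q * expR (- 1)) A.
  have [|s s0 hs] := large.
    by rewrite -expRN; apply/ltW/(lt_le_trans Aq); rewrite ler_peMr// ltW.
  exists s => //; apply: (le_trans hs); rewrite Bgt//.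
  have : 0 < D * (expR 1 * A) by rewrite !mulr_gt0.
  lra.
set L := ln (q / A).
have L1 : 1 <= L by rewrite -le_ln_expR.
have L0 : 0 < L by lra.
have qLB : q / L <= B by exact: Bln.
have AE : A = q * expR (- L).
  by rewrite /L expRN lnK ?posrE ?divr_gt0// invf_div mulrC divfK ?gt_eqF.
have DB : D * (q / L) <= D * B by rewrite ler_pM2l.
have qL0 : 0 < q / L by rewrite divr_gt0.
(* For D <= e^(L/2) the choice s = L/2 works: as A = q e^(-L), the exponent is at most e^(-L)
   e^(L/2) e^(L/2) = 1, and the value at most 2 q/L. *)
have [DL|DL] := leP D (expR (L / 2)).
  exists (L / 2); first by rewrite divr_gt0.
  have h : A * D * (expR (L / 2) - 1) / q <= 1.
    rewrite ler_pdivrMr// mul1r AE.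
    have h1 : expR (- L) * (expR (L / 2) * expR (L / 2)) = 1.
      by rewrite -!expRD -[RHS]expR0; congr expR; lra.
    have h2 : D * (expR (L / 2) - 1) <= expR (L / 2) * expR (L / 2).
      by have := expR_gt0 (L / 2); nra.
    by rewrite -!mulrA ger_pMr// -[leRHS]h1 ler_pM2l ?expR_gt0.
  apply: (@le_trans _ _ (q / (expR 1 * (L / 2)) * expR 1)).
    by rewrite ler_pM2l ?ler_expR// divr_gt0// mulr_gt0// divr_gt0.
  have -> : q / (expR 1 * (L / 2)) * expR 1 = 2 * (q / L).
    by field; rewrite ?gt_eqF.
  nra.
have [qM|qM] := leP (q / expR 1) (A * D).
  have [s s0 hs] := large qM; exists s => //; apply: (le_trans hs).
  have h : A <= q / L.
    rewrite AE ler_pM2l// expRN lef_pV2 ?posrE ?expR_gt0//.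
    by have := expR_ge1Dx L; lra.
  have : A * D <= D * B by rewrite mulrC ler_pM2l//; exact: le_trans qLB.
  nra.
(* Here the mean is below q/e, so s = 1 keeps the exponent below 1 and the value at most q = L
   (q/L); D > e^(L/2) >= L/2 absorbs the factor L. *)
exists 1 => //; rewrite mulr1.
apply: (@le_trans _ _ (q / expR 1 * expR 1)).
  rewrite ler_pM2l ?divr_gt0// ler_expR ler_pdivrMr// mul1r.
  apply: (@le_trans _ _ (A * D * expR 1)); first by rewrite ler_pM2l//; lra.
  by rewrite -ler_pdivlMr// ltW.
rewrite divfK ?gt_eqF//.
have h : L / 2 <= D by apply: le_trans (ltW DL); have := expR_ge1Dx (L / 2); lra.
have -> : q = L * (q / L) by field; rewrite gt_eqF.
nra.
Qed.

End constants.

Section constants.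
Context {R : realType}.
Implicit Types p q A D L eps : R.

Lemma expR_le_1B eps : 0 <= eps <= 2^-1 -> expR (- (2 * eps)) <= 1 - eps.
Proof.
move=> /andP[e0 e2]; rewrite expRN; have := expR_ge1Dx (2 * eps).
have E0 := expR_gt0 (2 * eps); rewrite -[_^-1]mul1r ler_pdivrMr//; nra.
Qed.

(** The choice is r = floor (q/L) and d = floor (e^q) + 1, where L = ln (q/A) lies in [1, q]. The
    mass is bounded below by (d eps/r)^r (1 - eps)^d, and both factors are exponentials of a
    multiple of -q, hence harmless after taking the power 1/q. *)
Lemma binomial_mass_lower_bound p A : 1 < p -> 0 < A ->
  let q := p / (p - 1) in
  q * expR (- q) <= A -> A <= q * expR (- 1) ->
  exists d r : nat, let eps := A / d%:R `^ p^-1 in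
    [/\ (1 <= r <= d)%N, eps <= 2^-1, q / ln (q / A) <= 2 * r%:R,
        d%:R `^ q^-1 <= expR 2 &
        expR (- (1 + 2 * expR 1) * q) <=
        'C(d, r)%:R * (eps ^+ r * (1 - eps) ^+ (d - r))].
Proof.
move=> p1 A0 q; have q1 : 1 < q := conjugate_gt1 p1.
have pq : p^-1 + q^-1 = 1 := conjugate_inv p1.
have p0 := lt_trans ltr01 p1.
clearbody q => qA Aq; have q0 := lt_trans ltr01 q1.
set L := ln (q / A).
have L1 : 1 <= L by rewrite -le_ln_expR.
have L0 : 0 < L by lra.
have AE : A = q * expR (- L).
  by rewrite /L expRN lnK ?posrE ?divr_gt0// invf_div mulrC divfK ?gt_eqF.
have Lq : L <= q.
  by move: qA; rewrite AE ler_pM2l// ler_expR; lra.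
have qL1 : 1 <= q / L by rewrite ler_pdivlMr// mul1r.
pose r := Num.truncn (q / L).
have /andP[rq qr] : r%:R <= q / L < r.+1%:R by apply: truncn_itv; lra.
pose d := (Num.truncn (expR q)).+1.
have Eq0 := expR_gt0 q.
have /andP[dq qd] : (Num.truncn (expR q))%:R <= expR q < d%:R.
  by apply: truncn_itv; exact: ltW.
have {}dq : d%:R <= 1 + expR q by rewrite /d -natr1; lra.
have r1 : (1 <= r)%N by rewrite -ltnS -(ltr_nat R); lra.
have r1R : 1 <= r%:R :> R by rewrite ler1n.
have r0R : 0 < r%:R :> R by lra.
have qe : 1 + q <= expR q := expR_ge1Dx q.
have qLq : q / L <= q by rewrite ler_pdivrMr// ler_peMr// ltW.
have rd : (r <= d)%N by rewrite -(ler_nat R); lra.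
have d1 : 1 <= d%:R :> R by rewrite ler1n.
clearbody d r.
have d0 : 0 < d%:R :> R by lra.
have ip0 : 0 < p^-1 by rewrite invr_gt0.
have iq0 : 0 < q^-1 by rewrite invr_gt0.
pose D := d%:R `^ q^-1; pose E := d%:R `^ p^-1.
have D1 : 1 <= D by rewrite -(powRr0 d%:R) ler_powR// ltW.
have E0 : 0 < E by rewrite powR_gt0.
have DE : d%:R = D * E.
  by rewrite -powRD ?[q^-1 + _]addrC ?pq ?powRr1 ?(ltW d0)// (gt_eqF d0) implybT.
have De : D <= expR 2.
  have -> : expR 2 = expR (2 * q) `^ q^-1 :> R by rewrite -expRM mulfK ?gt_eqF.
  apply: ge0_ler_powR; rewrite ?nnegrE ?expR_ge0 ?ltW//.
  apply: le_lt_trans dq _; rewrite mulr_natl mulr2n expRD.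
  nra.
pose eps := A / E.
(* Since q/p = q - 1, d > e^q gives d^(1/p) >= e^(q-1) >= q; with A <= q/e this forces eps <=
   1/2. *)
have Ee : q <= E.
  apply: (@le_trans _ _ (expR (q - 1))); first by have := expR_ge1Dx (q - 1); lra.
  have -> : q - 1 = q * p^-1.
    have -> : p^-1 = 1 - q^-1 by rewrite -pq addrK.
    by rewrite mulrBr mulr1 mulfV ?gt_eqF.
  by rewrite expRM; apply: ge0_ler_powR; rewrite ?nnegrE ltW.
have e2 := expR1_ge2 (R := R).
have Aq2 : A <= q / 2.
  by apply: le_trans Aq _; rewrite expRN ler_pM2l// lef_pV2 ?posrE//; lra.
have eps2 : eps <= 2^-1 by rewrite ler_pdivrMr//; lra.
have eps0 : 0 < eps by rewrite divr_gt0.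
have dE : d%:R * eps = A * D by rewrite DE /eps; field; rewrite gt_eqF.
exists d, r; split => //; first by rewrite r1.
  by move: qr; rewrite -natr1; lra.
rewrite -/E -/eps.
(* (1 - eps)^d >= e^(-2 eps d), where eps d = A D <= (q/e) e^2 = e q. *)
have h1 : expR (- (2 * expR 1 * q)) <= (1 - eps) ^+ (d - r).
  apply: (@le_trans _ _ ((1 - eps) ^+ d)); last first.
    by rewrite ler_wiXn2l ?leq_subr//; lra.
  apply: (@le_trans _ _ (expR (- (2 * eps)) ^+ d)); last first.
    by rewrite lerXn2r ?nnegrE ?expR_ge0 ?expR_le_1B//; lra.
  rewrite -expRM_natr ler_expR mulNr lerN2.
  have -> : 2 * eps * d%:R = 2 * (A * D) by rewrite -dE; ring.
  rewrite -mulrA ler_pM2l//.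
  apply: (@le_trans _ _ (q * expR (- 1) * expR 2)).
    by apply: ler_pM => //; lra.
  by rewrite -mulrA -expRD mulrC ler_pM2r// ler_expR; lra.
(* As A = q e^(-L), D >= 1 and r <= q, the ratio d eps/r = A D/r is at least e^(-L); its r-th power
   is at least e^(-q) because r L <= q. *)
have h2 : expR (- q) <= 'C(d, r)%:R * eps ^+ r.
  apply: (@le_trans _ _ ((d%:R * eps / r%:R) ^+ r)); last first.
    rewrite mulrAC exprMn ler_wpM2r ?exprn_ge0 ?(ltW eps0)//.
    rewrite expr_div_n ler_pdivrMr ?exprn_gt0//.
    by rewrite -!natrX -natrM ler_nat leq_exp_bin.
  apply: (@le_trans _ _ (expR (- L) ^+ r)).
    rewrite -expRM_natr ler_expR mulNr lerN2 mulrC -ler_pdivlMr//.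
  rewrite lerXn2r ?nnegrE ?expR_ge0//.
    by rewrite dE divr_ge0 ?(ltW r0R)// mulr_ge0 ?(ltW A0)//; lra.
  rewrite ler_pdivlMr// dE AE.
  have : r%:R <= q by lra.
  have := expR_gt0 (- L); set x := expR _ => x0 rq'.
  by rewrite [q * x]mulrC -mulrA ler_pM2l// (le_trans rq')// ler_peMr// ltW.
rewrite mulrA mulNr mulrDl opprD expRD mul1r.
by apply: ler_pM; rewrite ?expR_ge0.
Qed.

End constants.

(** * Maximal functions of families with independent overlaps *)

(** This is e u <= e^u at u = s x/q, raised to the power q; equality occurs at the maximum x = q/s
    of x^q e^(-s x). *)
Lemma powR_le_expR (R : realType) (q s x : R) : 0 < q -> 0 < s -> 0 <= x ->
  x `^ q <= (q / (expR 1 * s)) `^ q * expR (s * x).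
Proof.
move=> q0 s0 x0; have e0 := expR_gt0 (1 : R).
have -> : expR (s * x) = expR (s * x / q) `^ q.
  by rewrite -expRM divfK ?gt_eqF.
rewrite -powRM ?expR_ge0 ?divr_ge0 ?mulr_ge0 ?(ltW s0) ?(ltW e0) ?(ltW q0)//.
apply: ge0_ler_powR; rewrite ?nnegrE ?(ltW q0)//.
  by rewrite mulr_ge0 ?expR_ge0 ?divr_ge0 ?mulr_ge0 ?(ltW s0) ?(ltW e0) ?(ltW q0).
have h : expR 1 * (s * x / q) <= expR (s * x / q).
  have := expR_ge1Dx (s * x / q - 1); rewrite addrCA subrr addr0 => h.
  by rewrite -[in leRHS](subrK 1 (s * x / q)) expRD [leRHS]mulrC ler_pM2l.
have xE : x = q / (expR 1 * s) * (expR 1 * (s * x / q)).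
  by field; rewrite ?gt_eqF.
rewrite [leLHS]xE.
by rewrite ler_wpM2l ?divr_ge0 ?mulr_ge0 ?(ltW s0) ?(ltW e0) ?(ltW q0).
Qed.

Section maximal_weak_type.
Context d (T : measurableType d) (R : realType) (mu : probability T R).
Implicit Types (F : set (set T)) (f : T -> R) (l p : R).

Local Notation m A := (fine (mu A)).

Lemma measurable_sum_indic (I : finType) (c : I -> R) (A : I -> set T) :
  (forall i, measurable (A i)) ->
  measurable_fun setT (fun x => \sum_i c i * \1_(A i) x).
Proof. by move=> mA; apply: measurable_sum => i; exact: measurable_funM. Qed.

Lemma integral_sum_indic (I : finType) (c : I -> R) (A : I -> set T) :
  (forall i, 0 <= c i) -> (forall i, measurable (A i)) ->
  (\int[mu]_x (\sum_i c i * \1_(A i) x)%:E = (\sum_i c i * m (A i))%:E)%E.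
Proof.
move=> c0 mA; under eq_integral do rewrite -sumEFin.
rewrite ge0_integral_sum//; last 2 first.
- by move=> i; apply/measurable_EFinP; exact: measurable_funM.
- by move=> i x _; rewrite lee_fin mulr_ge0.
rewrite -sumEFin; apply: eq_bigr => i _.
rewrite (integralZl_indic _ (fun=> A i))//; last first.
  by move=> /lt_geF; rewrite c0.
by rewrite integral_indic// setIT EFinM fineK// fin_num_measure.
Qed.

(** Pointwise comparisons of combinations of indicators are integrated into inequalities between
    real numbers, which avoids extended arithmetic below. *)
Lemma sum_measure_le (I J : finType) (a : I -> R) (b : J -> R)
    (A : I -> set T) (B : J -> set T) :
  (forall i, 0 <= a i) -> (forall j, 0 <= b j) ->
  (forall i, measurable (A i)) -> (forall j, measurable (B j)) ->
  (forall x, \sum_i a i * \1_(A i) x <= \sum_j b j * \1_(B j) x) ->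
  \sum_i a i * m (A i) <= \sum_j b j * m (B j).
Proof.
move=> a0 b0 mA mB AB; rewrite -lee_fin -!integral_sum_indic//.
apply: ge0_le_integral => //.
- by move=> x _; rewrite lee_fin sumr_ge0// => i _; rewrite mulr_ge0.
- exact/measurable_EFinP/measurable_sum_indic.
- exact/measurable_EFinP/measurable_sum_indic.
- by move=> x _; rewrite lee_fin.
Qed.

(** The default value 0 of [maximal] off the union of the family never exceeds l >= 0, and a
    supremum exceeds l exactly when one of the averages does. *)
Lemma superlevel_maximal F f l : 0 <= l ->
  [set x | (l%:E < maximal mu F f x)%E] =
  \bigcup_(Q in [set Q | F Q /\
      (l%:E < (m Q)^-1%:E * \int[mu]_(y in Q) `|f y|%:E)%E]) Q.
Proof.
move=> l0; apply/seteqP; split => x /=.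
  rewrite /maximal; case: asboolP => [_|_]; last by rewrite lte_fin ltNge l0.
  by move=> /ereal_sup_gt[_ /= [Q [FQ Qx] <-] lQ]; exists Q.
move=> [Q [FQ lQ] Qx]; rewrite /maximal; case: asboolP => [_|[]]; last by exists Q.
by apply: lt_le_trans lQ _; apply: ereal_sup_ubound; exists Q.
Qed.

Definition pattern n (B : 'I_n -> set T) x : {set 'I_n} := [set k | x \in B k]%SET.

(** The law of n independent Bernoulli trials of parameter eps: the probability that exactly the
    indices in J succeed. *)
Definition weight n (eps : R) (J : {set 'I_n}) :=
  \prod_k (if k \in J then eps else 1 - eps).

(* A family with the geometry of a configuration around Q: members meet only
   inside Q, in which they cut out independent events of probability eps. *)
Record overlapping_family (eps v : R) n (Q : set T) (B : 'I_n -> set T) : Prop := {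
  overlap_v : 0 < v ;
  overlap_eps : 0 < eps <= 2^-1 ;
  overlap_mQ : measurable Q ;
  overlap_mB : forall k, measurable (B k) ;
  overlap_B : forall k, mu (B k) = v%:E ;
  overlap_sub : forall j k x, j != k -> B j x -> B k x -> Q x ;
  overlap_law : forall J, mu (Q `&` [set x | pattern B x = J]) =
    (v * weight eps J)%:E }.

(** The exponential moment of a binomial variable with [#|S|] trials, by expanding a product over
    subsets; indices outside S give the factor eps + (1 - eps) = 1. *)
Lemma sum_expR_weight n (eps s : R) (S : {set 'I_n}) :
  \sum_J expR (s * #|S :&: J|%:R) * weight eps J =
  (1 + eps * (expR s - 1)) ^+ #|S|.
Proof.
transitivity (\prod_(k < n) ((if k \in S then expR s else 1) * eps + (1 - eps))).
  rewrite bigA_distr; apply: eq_big => [J|J _]; first by rewrite inE.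
  have -> : expR (s * #|S :&: J|%:R) =
      \prod_k (if k \in J then if k \in S then expR s else 1 else 1).
    rewrite expRM_natr -prodr_const big_mkcond; apply: eq_bigr => k _.
    by rewrite inE; case: (k \in J); case: (k \in S).
  by rewrite /weight -big_split /=; apply: eq_bigr => k _; case: ifP; rewrite ?mul1r.
rewrite -prodr_const [RHS]big_mkcond; apply: eq_bigr => k _.
by case: ifP => _; ring.
Qed.

Lemma measurable_pattern n Q (B : 'I_n -> set T) (J : {set 'I_n}) :
  measurable Q -> (forall k, measurable (B k)) ->
  measurable (Q `&` [set x | pattern B x = J]).
Proof.
move=> mQ mB; apply: measurableI => //.
have -> : [set x | pattern B x = J] =
    \bigcap_(k in setT) (if k \in J then B k else ~` B k).
  apply/seteqP; split => x /=.
    move=> <- k _; rewrite inE; case: ifPn => [|/negP].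
      by rewrite inE.
    by rewrite inE.
  move=> h; apply/setP => k; rewrite inE; have := h k Logic.I.
  by case: ifPn => _ hk; [rewrite mem_set|rewrite memNset].
by apply: fin_bigcap_measurable => // k _; case: ifPn => // _; exact: measurableC.
Qed.

(** * Moments of the overlap count and the weak-type upper bound *)

Section upper_bound.
Variables (p q eps v : R) (n : nat) (Q : set T) (B : 'I_n -> set T).
Hypotheses (p1 : 1 < p) (qE : q = p / (p - 1))
  (QB : overlapping_family eps v Q B).

(** Off Q the count is 0 or 1, hence equal to its q-th power; on Q only the term J = [pattern B x]
    survives, and [powR_le_expR] bounds it. Indexing both kinds of terms by one sum type lets
    [integral_sum_indic] integrate the majorant at once. *)
Lemma overlap_count_powR (S : {set 'I_n}) (s : R) x : 0 < s ->
  (\sum_(k in S) \1_(B k) x) `^ q <=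
  \sum_(i : 'I_n + {set 'I_n})
     (match i with
      | inl k => (k \in S)%:R
      | inr J => (q / (expR 1 * s)) `^ q * expR (s * #|S :&: J|%:R)
      end) *
     \1_(match i with
         | inl k => B k `\` Q
         | inr J => Q `&` [set x | pattern B x = J]
         end) x.
Proof.
move=> s0; have q1 : 1 < q by rewrite qE conjugate_gt1.
have q0 := lt_trans ltr01 q1.
rewrite big_sumType /=.
have [Qx|Qx] := pselect (Q x).
  rewrite ler_wpDl//; first by apply: sumr_ge0 => k _; rewrite mulr_ge0.
  rewrite (bigD1 (pattern B x))//= ler_wpDr//.
    by apply: sumr_ge0 => J _; rewrite !mulr_ge0 ?powR_ge0 ?expR_ge0.
  rewrite indicE mem_set//= mulr1.
  have -> : \sum_(k in S) \1_(B k) x = #|S :&: pattern B x|%:R :> R.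
    rewrite -sum1_card natr_sum big_mkcond [RHS]big_mkcond/=.
    apply: eq_bigr => k _; rewrite !inE indicE.
    by case: (k \in S) => //=; case: (x \in B k).
  exact: powR_le_expR.
rewrite ler_wpDr//.
  by apply: sumr_ge0 => J _; rewrite !mulr_ge0 ?powR_ge0 ?expR_ge0.
have -> : \sum_k (k \in S)%:R * \1_(B k `\` Q) x = \sum_(k in S) \1_(B k) x :> R.
  rewrite [RHS]big_mkcond; apply: eq_bigr => k _; rewrite !indicE.
  case: (k \in S); rewrite ?mul0r// mul1r; congr (nat_of_bool _)%:R.
  by apply/idP/idP; rewrite !inE//= => -[].
have [k /andP[kS Bkx]|none] := pickP [pred k | (k \in S) && (x \in B k)].
  rewrite (bigD1 k)//= indicE Bkx big1 ?addr0 ?powR1// => j /andP[jS jk].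
  rewrite indicE memNset// => Bjx; apply: Qx.
  by apply: (overlap_sub QB jk Bjx); rewrite inE in Bkx.
rewrite big1 ?powR0 ?gt_eqF// => k kS; rewrite indicE.
by have := none k; rewrite /= kS /= => ->.
Qed.

(** Integrating the majorant gives at most [#|S|] v off Q and v a^q (1 + eps (e^s - 1))^[#|S|] on Q.
    The latter is controlled by [exponential_moment_parameter] with D = [#|S|]^(1/q), whose q-th
    power restores the factor [#|S|]. *)
Lemma overlap_count_Lnorm (S : {set 'I_n}) : (0 < #|S|)%N ->
  ('N[mu]_q%:E[EFin \o (fun x => (\sum_(k in S) \1_(B k) x)%R)] <=
   ((#|S|%:R * v) `^ q^-1 * (8 * Bp p (eps * n%:R `^ p^-1)))%:E)%E.
Proof.
move=> S0; have q1 : 1 < q by rewrite qE conjugate_gt1.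
have q0 := lt_trans ltr01 q1.
have pq : p^-1 + q^-1 = 1 by rewrite qE conjugate_inv.
have p0 := lt_trans ltr01 p1.
have v0 := overlap_v QB; have eps01 := overlap_eps QB.
have Sn : (#|S| <= n)%N by rewrite -[leqRHS]card_ord max_card.
have S1 : 1 <= #|S|%:R :> R by rewrite ler1n.
have n0 : 0 < n%:R :> R by rewrite ltr0n (leq_trans S0).
pose A := eps * n%:R `^ p^-1; rewrite -/A.
have A0 : 0 < A by rewrite mulr_gt0 ?powR_gt0//; lra.
have B1 : 1 <= Bp p A := Bp_ge1 p1 A0.
have B0 := le_trans ler01 B1.
pose D := #|S|%:R `^ q^-1 : R.
have D1 : 1 <= D by rewrite -(powRr0 #|S|%:R) ler_powR// invr_ge0 ltW.
have D0 := le_trans ler01 D1.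
have [s s0] := exponential_moment_parameter p1 A0 D1; rewrite -qE.
set a := q / _ => aE.
have a0 : 0 <= a by rewrite divr_ge0 ?mulr_ge0 ?expR_ge0 ?ltW.
have mN : measurable_fun setT (fun x => \sum_(k in S) \1_(B k) x : R).
  have -> : (fun x => \sum_(k in S) \1_(B k) x : R) =
      (fun x => \sum_k (k \in S)%:R * \1_(B k) x).
    apply/funext => x; rewrite big_mkcond; apply: eq_bigr => k _.
    by case: ifP; rewrite ?mul1r ?mul0r.
  exact/measurable_sum_indic/(overlap_mB QB).
have N0 x : 0 <= \sum_(k in S) \1_(B k) x :> R by apply: sumr_ge0.
set c := fun i : 'I_n + {set 'I_n} => match i with
   | inl k => (k \in S)%:R
   | inr J => a `^ q * expR (s * #|S :&: J|%:R)
   end.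
set E := fun i : 'I_n + {set 'I_n} => match i with
   | inl k => B k `\` Q
   | inr J => Q `&` [set x | pattern B x = J]
   end.
have c0 i : 0 <= c i by case: i => [k|J] /=; rewrite ?mulr_ge0 ?powR_ge0 ?expR_ge0.
have mE i : measurable (E i).
  case: i => [k|J] /=.
    by apply: measurableD; [exact: (overlap_mB QB)|exact: (overlap_mQ QB)].
  by apply: measurable_pattern; [exact: (overlap_mQ QB)|exact: (overlap_mB QB)].
have bound : \sum_i c i * m (E i) <= #|S|%:R * v * (8 * Bp p A) `^ q.
  rewrite big_sumType /=.
  apply: (@le_trans _ _ (#|S|%:R * v + v * (#|S|%:R * (4 * Bp p A) `^ q))).
    apply: lerD.
      rewrite -sum1_card natr_sum mulr_suml [leRHS]big_mkcond /=.
      apply: ler_sum => k _; case: (k \in S); rewrite ?mul0r// !mul1r.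
      have -> : v = m (B k) by rewrite (overlap_B QB).
      have mk := mE (inl k); have mBk := overlap_mB QB k.
      rewrite fine_le ?fin_num_measure//.
      by apply: le_measure; rewrite ?inE// => x [].
    have -> : \sum_J a `^ q * expR (s * #|S :&: J|%:R) *
          m (Q `&` [set x | pattern B x = J]) =
        v * (a `^ q * (1 + eps * (expR s - 1)) ^+ #|S|).
      rewrite -sum_expR_weight !mulr_sumr; apply: eq_bigr => J _.
      by rewrite (overlap_law QB) /=; ring.
    rewrite ler_pM2l//.
    apply: (@le_trans _ _ ((a * expR (A * D * (expR s - 1) / q)) `^ q)).
      rewrite powRM ?expR_ge0// -expRM divfK ?gt_eqF// ler_wpM2l ?powR_ge0//.
      have es : 0 <= expR s - 1 by have := expR_ge1Dx s; lra.
      apply: (@le_trans _ _ (expR (eps * (expR s - 1)) ^+ #|S|)).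
        have ? : 0 <= eps * (expR s - 1) by rewrite mulr_ge0//; lra.
        rewrite lerXn2r ?nnegrE ?expR_ge0//; first lra.
        exact: expR_ge1Dx.
      rewrite -expRM_natr ler_expR.
      (* Split [#|S|] as [#|S|]^(1/p) D and enlarge the first factor to n^(1/p). *)
      have : eps * #|S|%:R <= A * D.
        have SE : #|S|%:R = #|S|%:R `^ p^-1 * D :> R.
          by rewrite -powRD ?pq ?powRr1// gt_eqF ?implybT//; lra.
        rewrite [in leLHS]SE mulrA ler_wpM2r ?powR_ge0// /A ler_wpM2l//; first lra.
        by apply: ge0_ler_powR; rewrite ?nnegrE ?invr_ge0 ?(ltW p0) ?ler_nat.
      by move=> h; rewrite mulrAC ler_wpM2r.
    apply: (@le_trans _ _ ((4 * D * Bp p A) `^ q)).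
      apply: ge0_ler_powR; rewrite ?nnegrE ?(ltW q0) ?(mulr_ge0 a0) ?expR_ge0//.
      by rewrite !mulr_ge0.
    rewrite [4 * D]mulrC -mulrA powRM ?mulr_ge0//; try lra.
    by rewrite -powRrM mulVf ?gt_eqF// powRr1.
  (* With X = (4 [Bp p A])^q >= 1, the two contributions add up to 1 + X <= 2 X <= 2^q X; this
     doubles 4 to 8. *)
  have -> : 8 * Bp p A = 2 * (4 * Bp p A) by ring.
  rewrite [(2 * _) `^ _]powRM//; try lra.
  have h2 : 2 <= 2 `^ q :> R by rewrite -[leLHS]powRr1// ler_powR ?(ltW q1)//; lra.
  have h4 : 1 <= (4 * Bp p A) `^ q.
    by rewrite -[leLHS](powRr0 (4 * Bp p A)) ler_powR ?(ltW q0)//; lra.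
  have h0 : 0 <= #|S|%:R * v by rewrite mulr_ge0// ltW.
  set X := (4 * Bp p A) `^ q in h4 *.
  have -> : #|S|%:R * v + v * (#|S|%:R * X) = #|S|%:R * v * (1 + X) by ring.
  by rewrite ler_wpM2l//; nra.
rewrite unlock /=.
have -> : (#|S|%:R * v) `^ q^-1 * (8 * Bp p A) =
    (#|S|%:R * v * (8 * Bp p A) `^ q) `^ q^-1.
  rewrite [RHS]powRM ?powR_ge0 ?mulr_ge0 ?(ltW v0)// -powRrM mulfV ?gt_eqF//.
  by rewrite powRr1// mulr_ge0.
rewrite -poweR_EFin; apply: gt0_ler_poweR.
- by rewrite invr_ge0 ltW.
- by rewrite in_itv/= leey andbT integral_ge0// => x _; rewrite poweR_ge0.
- by rewrite in_itv/= leey andbT lee_fin !mulr_ge0 ?powR_ge0// ltW.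
apply: (@le_trans _ _ (\int[mu]_x (\sum_i c i * \1_(E i) x)%:E)%E).
  apply: ge0_le_integral => //.
  - apply/measurable_EFinP/(measurableT_comp (measurable_powR q)).
    exact: measurableT_comp.
  - exact/measurable_EFinP/measurable_sum_indic.
  - by move=> x _; rewrite lee_fin ger0_norm// overlap_count_powR.
by rewrite integral_sum_indic// lee_fin.
Qed.

End upper_bound.

End maximal_weak_type.

Section weak_type_upper_bound.
Context d (T : measurableType d) (R : realType) (mu : probability T R).
Implicit Type p : R.

Local Notation m A := (fine (mu A)).

(** For S the indices whose averages exceed l, the superlevel set has measure at most w = [#|S|] v.
    Hoelder gives l w <= 8 [Bp p A] |f|_p w^(1/q), and cancelling w^(1/q) leaves the weak-type
    inequality with w^(1/p). *)
Lemma weak_type_norm_le (p eps v : R) n (Q : set T) (B : 'I_n -> set T) :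
  1 < p -> (0 < n)%N -> overlapping_family mu eps v Q B ->
  (weak_type_norm mu p (range B) <= (8 * Bp p (eps * n%:R `^ p^-1))%:E)%E.
Proof.
move=> p1 n0 QB; have v0 := overlap_v QB; have eps01 := overlap_eps QB.
have mB := overlap_mB QB.
pose q := p / (p - 1); have q1 : 1 < q := conjugate_gt1 p1.
have q0 := lt_trans ltr01 q1; have p0 := lt_trans ltr01 p1.
have pq : p^-1 + q^-1 = 1 := conjugate_inv p1.
pose A := eps * n%:R `^ p^-1; rewrite -/A.
have A0 : 0 < A by rewrite mulr_gt0 ?powR_gt0 ?ltr0n//; lra.
have B0 := le_trans ler01 (Bp_ge1 p1 A0).
have K0 : 0 <= 8 * Bp p A by rewrite mulr_ge0.
apply: ereal_inf_lbound; split => [|f]; first by rewrite lee_fin.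
rewrite inE => /andP[/= mf fin_f] l l0.
have {mf} : measurable_fun setT f by rewrite inE in mf.
move=> mf; rewrite inE /= in fin_f.
have Nf : ('N[mu]_p%:E[EFin \o f])%E \is a fin_num.
  by rewrite ge0_fin_numE ?Lnorm_ge0.
pose S := [set k | (l%:E < (m (B k))^-1%:E * \int[mu]_(y in B k) `|f y|%:E)%E]%SET.
rewrite superlevel_maximal ?(ltW l0)//.
set U := \bigcup_(_ in _) _.
have UE : U = \bigcup_(k in [set` S]) B k.
  apply/seteqP; split => x [].
    by move=> _ [[k _ <-] lk] Bkx; exists k => //=; rewrite inE.
  by move=> k /=; rewrite inE => lk Bkx; exists (B k) => //; split => //; exists k.
have mU : measurable U.
  by rewrite UE; apply: fin_bigcup_measurable => //; exact: finite_finset.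
have muU : m U <= #|S|%:R * v.
  have : \sum_(i < 1) 1 * m U <= \sum_k (k \in S)%:R * m (B k).
    apply: (@sum_measure_le _ _ _ mu _ _ (fun=> 1) _ (fun=> U)) => // x.
    rewrite big_ord1 mul1r indicE.
    have [|_] := boolP (x \in U); last by rewrite sumr_ge0.
    rewrite inE UE => -[k /= kS Bkx].
    by rewrite (bigD1 k)//= kS mul1r indicE mem_set// lerDl sumr_ge0.
  rewrite big_ord1 mul1r => /le_trans; apply.
  rewrite -sum1_card natr_sum mulr_suml [leRHS]big_mkcond/= ler_sum// => k _.
  by rewrite (overlap_B QB); case: (k \in S); rewrite ?mul0r ?mul1r.
have [u [muUfin mU0 {}muU]] :
    exists u, [/\ mu U = u%:E, 0 <= u & u <= #|S|%:R * v].
  by exists (m U); rewrite fineK ?fine_ge0// fin_num_measure.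
rewrite muUfin poweR_EFin -(fineK Nf) -!EFinM lee_fin.
set Nr := fine _; have Nr0 : 0 <= Nr by rewrite fine_ge0// Lnorm_ge0.
(* An empty selection is treated apart because w > 0 is needed for the cancellation. *)
have [S0|S0] := posnP #|S|.
  have -> : u = 0 by apply: le_anti; rewrite mU0 (le_trans muU)// S0 mul0r.
  by rewrite powR0 ?invr_eq0 ?gt_eqF// mulr0 mulr_ge0.
pose w := #|S|%:R * v.
have w0 : 0 < w by rewrite mulr_gt0// ltr0n.
set g := fun x => (\sum_(k in S) \1_(B k) x) : R.
have mg : measurable_fun setT g.
  have -> : g = (fun x => \sum_k (k \in S)%:R * \1_(B k) x).
    apply/funext => x; rewrite /g big_mkcond; apply: eq_bigr => k _.
    by case: ifP; rewrite ?mul1r ?mul0r.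
  exact: measurable_sum_indic.
have main : l * w <= Nr * (w `^ q^-1 * (8 * Bp p A)).
  rewrite -lee_fin [leRHS]EFinM fineK//.
  apply: (@le_trans _ _ ('N[mu]_p%:E[EFin \o f] * 'N[mu]_q%:E[EFin \o g])%E);
    last first.
    rewrite lee_wpmul2l ?Lnorm_ge0//.
    exact: (overlap_count_Lnorm p1 (erefl q) QB S0).
  apply: le_trans (hoelder _ mf mg p0 q0 pq).
  rewrite Lnorm1.
  have -> : (\int[mu]_x `|(EFin \o (f \* g)%R) x| =
      \sum_(k in S) \int[mu]_(x in B k) `|f x|%:E)%E.
    under [RHS]eq_bigr => k _ do rewrite integral_mkcond.
    rewrite -big_enum /= -ge0_integral_sum//; last 2 first.
    - move=> k; apply/(measurable_restrictT _ _).1 => //.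
      exact/measurable_EFinP/measurableT_comp/measurable_funTS.
    - by move=> k x _; rewrite erestrict_ge0.
    apply: eq_integral => x _; rewrite /= normrM [`|g x|]ger0_norm ?sumr_ge0//.
    rewrite big_enum /= mulr_sumr -sumEFin; apply: eq_bigr => k _.
    by rewrite patchE indicE; case: ifP; rewrite ?mulr1 ?mulr0.
  have -> : ((l * w)%:E = \sum_(k in S) (l * v)%:E)%E.
    by rewrite sumEFin sumr_const /w -mulr_natl; congr EFin; ring.
  apply: lee_sum => k; rewrite inE (overlap_B QB) /= => /ltW lk.
  by rewrite mulrC EFinM -lee_pdivlMl.
have wp : 0 < w `^ p^-1 by rewrite powR_gt0.
have wq : 0 < w `^ q^-1 by rewrite powR_gt0.
have wE : w = w `^ p^-1 * w `^ q^-1.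
  by rewrite -powRD ?pq ?powRr1 ?(ltW w0)// (gt_eqF w0) implybT.
apply: (@le_trans _ _ (l * w `^ p^-1)).
  rewrite ler_wpM2l ?(ltW l0)//.
  by apply: ge0_ler_powR; rewrite ?nnegrE ?invr_ge0 ?(ltW p0) ?(ltW w0).
rewrite -(ler_pM2r wq).
have -> : l * w `^ p^-1 * w `^ q^-1 = l * w by rewrite [in RHS]wE mulrA.
by apply: le_trans main _; rewrite [leRHS]mulrC mulrCA [Nr * _]mulrC.
Qed.

End weak_type_upper_bound.

(** * Lower bounds from indicator test functions *)

Section weak_type_lower_bound.
Context d (T : measurableType d) (R : realType) (mu : probability T R).
Implicit Type p : R.

Local Notation m A := (fine (mu A)).

Lemma sum_measure_eq (I J : finType) (a : I -> R) (b : J -> R)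
    (A : I -> set T) (B : J -> set T) :
  (forall i, 0 <= a i) -> (forall j, 0 <= b j) ->
  (forall i, measurable (A i)) -> (forall j, measurable (B j)) ->
  (forall x, \sum_i a i * \1_(A i) x = \sum_j b j * \1_(B j) x) ->
  \sum_i a i * m (A i) = \sum_j b j * m (B j).
Proof.
move=> a0 b0 mA mB AB; apply: le_anti.
by rewrite !sum_measure_le// => x; rewrite AB.
Qed.

Lemma Lnorm_indic p (G : set T) : 0 < p -> measurable G ->
  ('N[mu]_p%:E[EFin \o \1_G] = (m G `^ p^-1)%:E)%E.
Proof.
move=> p0 mG; rewrite unlock /=.
have -> : (\int[mu]_x `|(\1_G x)%:E| `^ p = \int[mu]_x (\1_G x)%:E)%E.
  apply: eq_integral => x _; rewrite /= indicE.
  by case: (x \in G); rewrite ?normr1 ?powR1// normr0 powR0 ?gt_eqF.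
by rewrite integral_indic// setIT -poweR_EFin fineK// fin_num_measure.
Qed.

(** The indicator of G has average at least alpha over each [B k] with k in S. Testing at level
    alpha/2 makes the strict inequality hold there, so the superlevel set contains their union. *)
Lemma weak_type_norm_ge p (v alpha u : R) n (B : 'I_n -> set T)
    (G : set T) (S : {set 'I_n}) :
  0 < p -> 0 < v -> (forall k, measurable (B k)) ->
  (forall k, mu (B k) = v%:E) ->
  measurable G -> 0 < m G -> 0 < alpha ->
  (forall k, k \in S -> alpha * v <= m (G `&` B k)) ->
  0 <= u <= m (\bigcup_(k in [set` S]) B k) ->
  (((alpha / 2) * (u / m G) `^ p^-1)%:E <= weak_type_norm mu p (range B))%E.
Proof.
move=> p0 v0 mB Bv mG G0 a0 aG /andP[u0 uU].
apply: le_ereal_inf_tmp => K /= [K0 HK].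
have LG : \1_G \in Lfun mu p%:E.
  rewrite inE; apply/andP; split; first by rewrite inE/=; exact: measurable_indic.
  by rewrite inE /= /finite_norm Lnorm_indic// ltry.
have a20 : 0 < alpha / 2 by rewrite divr_gt0.
have := HK _ LG _ a20; rewrite Lnorm_indic// superlevel_maximal ?(ltW a20)//.
set W := \bigcup_(_ in _) _ => h.
have mW : measurable W.
  have -> : W = \bigcup_(k in [set k | ((alpha / 2)%:E <
      (m (B k))^-1%:E * \int[mu]_(y in B k) `|\1_G y|%:E)%E]) B k.
    apply/seteqP; split => x [].
      by move=> _ [[k _ <-] lk] Bkx; exists k.
    by move=> k /= lk Bkx; exists (B k) => //; split => //; exists k.
  by apply: fin_bigcup_measurable => //; exact: finite_finset.
have UW : \bigcup_(k in [set` S]) B k `<=` W.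
  move=> x [k /= kS Bkx]; exists (B k) => //; split; first by exists k.
  rewrite (_ : (\int[mu]_(y in B k) _ = (m (G `&` B k))%:E)%E); last first.
    under eq_integral do rewrite ger0_norm//.
    by rewrite integral_indic// fineK// fin_num_measure//; exact: measurableI.
  rewrite -EFinM lte_fin Bv /= [ltRHS]mulrC ltr_pdivlMr//.
  apply: lt_le_trans (aG _ kS); rewrite ltr_pM2r//; lra.
have mU : measurable (\bigcup_(k in [set` S]) B k).
  by apply: fin_bigcup_measurable => //; exact: finite_finset.
have uW : u <= m W.
  by apply: le_trans uU _; rewrite fine_le ?fin_num_measure// le_measure ?inE.
have {}h : ((alpha / 2 * u `^ p^-1)%:E <= K * (m G `^ p^-1)%:E)%E.
  apply: le_trans h; rewrite EFinM -(poweR_EFin u).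
  rewrite lee_wpmul2l ?lee_fin ?(ltW a20)//.
  apply: gt0_ler_poweR; rewrite ?in_itv/= ?leey ?andbT ?lee_fin//.
    by rewrite invr_ge0 ltW.
  by rewrite -(fineK (fin_num_measure mu _ mW)) lee_fin.
have Gp : 0 < m G `^ p^-1 by rewrite powR_gt0.
case: K K0 {HK} h => [k| |]; rewrite ?leey// => _.
rewrite -EFinM !lee_fin => h.
rewrite -(ler_pM2r Gp) -[leLHS]mulrA -powRM ?divr_ge0 ?(ltW G0)//.
by rewrite divfK ?gt_eqF.
Qed.

Lemma sum_weight n (eps : R) : \sum_(J : {set 'I_n}) weight eps J = 1 :> R.
Proof.
transitivity (\prod_(k < n) (eps + (1 - eps))); last first.
  by rewrite big1// => k _; rewrite addrC subrK.
by rewrite bigA_distr; apply: eq_bigl => J; rewrite inE.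
Qed.

(** Replacing the factor 1 - eps at k by 0 kills the subsets that miss k; the expanded product then
    has factor eps at k and 1 elsewhere. *)
Lemma sum_weight_mem n (eps : R) (k : 'I_n) :
  \sum_(J : {set 'I_n} | k \in J) weight eps J = eps.
Proof.
transitivity (\prod_(j < n) (eps + (if j == k then 0 else 1 - eps))); last first.
  rewrite (bigD1 k)//= eqxx addr0 big1 ?mulr1// => j /negbTE ->.
  by rewrite addrC subrK.
rewrite bigA_distr big_mkcond; apply: eq_big => [J|J _]; first by rewrite inE.
case: ifPn => kJ.
  apply: eq_bigr => j _; case: ifPn => // jJ.
  by case: eqVneq jJ => // ->; rewrite kJ.
by apply/esym; rewrite (bigD1 k)//= (negbTE kJ) eqxx mul0r.
Qed.

Lemma weightE n (eps : R) (J : {set 'I_n}) :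
  weight eps J = eps ^+ #|J| * (1 - eps) ^+ (n - #|J|).
Proof.
rewrite /weight (bigID [in J])/=; congr (_ * _).
  by rewrite (eq_bigr (fun=> eps)) ?prodr_const// => k ->.
rewrite (eq_bigr (fun=> 1 - eps)) => [|k /negbTE ->//].
have <- : #|~: J| = (n - #|J|)%N.
  by have := cardsC J; rewrite card_ord; lia.
by rewrite -prodr_const; apply: eq_bigl => k; rewrite inE.
Qed.

(** The (r+1)-subsets missing k are those of the complement of k; Pascal's rule counts the
    others. *)
Lemma card_draws_mem n r (k : 'I_n) :
  #|[set J : {set 'I_n} | (#|J| == r.+1) && (k \in J)]%SET| = 'C(n.-1, r).
Proof.
have n0 : (0 < n)%N by apply: leq_ltn_trans (ltn_ord k).
have h1 : #|[set J : {set 'I_n} | (#|J| == r.+1) && (k \notin J)]%SET| =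
    'C(n.-1, r.+1).
  have <- : #|~: [set k]%SET| = n.-1 by rewrite cardsC1 card_ord.
  rewrite -cards_draws; apply: eq_card => J; rewrite !inE andbC; congr (_ && _).
  by rewrite finset.subsetC finset.sub1set inE.
have := card_draws 'I_n r.+1.
rewrite card_ord -[in 'C(n, _)](prednK n0) binS -h1.
rewrite -(cardsID [set J : {set 'I_n} | k \in J]%SET).
have -> : #|([set A : {set 'I_n} | #|A| == r.+1] :\: [set J : {set 'I_n} | k \in J])%SET| =
   #|[set J : {set 'I_n} | (#|J| == r.+1) && (k \notin J)]%SET|.
  by apply: eq_card => J; rewrite !inE; case: (k \in J); case: (_ == _).
have -> : #|([set A : {set 'I_n} | #|A| == r.+1] :&: [set J : {set 'I_n} | k \in J])%SET| =
   #|[set J : {set 'I_n} | (#|J| == r.+1) && (k \in J)]%SET|.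
  by apply: eq_card => J; rewrite !inE; case: (k \in J); case: (_ == _).
lia.
Qed.

Section lower_bound.
Variables (p eps v : R) (n : nat) (Q : set T) (B : 'I_n -> set T).
Hypotheses (p1 : 1 < p) (QB : overlapping_family mu eps v Q B).

Lemma measurable_pattern_pred (P : pred {set 'I_n}) :
  measurable (Q `&` [set x | P (pattern B x)]).
Proof.
have -> : Q `&` [set x | P (pattern B x)] =
    \bigcup_(J in [set J | P J]) (Q `&` [set x | pattern B x = J]).
  apply/seteqP; split => x /=; first by move=> [Qx Px]; exists (pattern B x).
  by move=> [J PJ [Qx xJ]]; split => //; rewrite xJ.
apply: fin_bigcup_measurable; first exact: finite_finset.
by move=> J _; apply: measurable_pattern; [exact: overlap_mQ QB|exact: overlap_mB QB].
Qed.

(** Sums the law over the disjoint patterns satisfying P. Different choices of P give the measures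
    of Q, of its traces and of the level sets of the count. *)
Lemma measure_pattern_pred (P : pred {set 'I_n}) :
  m (Q `&` [set x | P (pattern B x)]) = v * \sum_(J | P J) weight eps J.
Proof.
have mP := measurable_pattern_pred.
have mJ J : measurable (Q `&` [set x | pattern B x = J]).
  by apply: measurable_pattern; [exact: overlap_mQ QB|exact: overlap_mB QB].
have := @sum_measure_eq 'I_1 _ (fun=> 1) (fun J => (P J)%:R)
  (fun=> Q `&` [set x | P (pattern B x)])
  (fun J => Q `&` [set x | pattern B x = J]).
rewrite big_ord1 mul1r => ->//; last first.
  move=> x; rewrite big_ord1 mul1r (bigD1 (pattern B x))//= big1; last first.
    move=> J Jx; rewrite indicE memNset ?mulr0//= => -[_ /= xJ].
    by rewrite xJ eqxx in Jx.
  rewrite addr0 !indicE -natrM; congr _%:R.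
  have [Qx|Qx] := pselect (Q x); last first.
    by rewrite !memNset ?muln0//= => -[].
  rewrite [X in (_ * nat_of_bool X)%N]mem_set//= muln1; congr nat_of_bool.
  by apply/idP/idP; rewrite inE => //= -[].
rewrite mulr_sumr [RHS]big_mkcond; apply: eq_bigr => J _.
by rewrite (overlap_law QB); case: (P J); rewrite ?mul1r ?mul0r.
Qed.

Lemma measure_overlap_base : m Q = v.
Proof.
have := measure_pattern_pred predT; rewrite sum_weight mulr1 => <-.
by congr (m _); apply/seteqP; split => x // [].
Qed.

Lemma measure_overlap k : m (Q `&` B k) = eps * v.
Proof.
have := measure_pattern_pred (fun J => k \in J); rewrite sum_weight_mem mulrC => <-.
congr (m _); apply/seteqP; split => x /= [Qx]; rewrite ?inE => h; split => //.
Qed.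

(** The sets [B k] minus Q are disjoint, each of measure (1 - eps) v >= v/2. *)
Lemma measure_overlap_union : n%:R * v / 2 <= m (\bigcup_k B k).
Proof.
have mB := overlap_mB QB; have mQ := overlap_mQ QB.
have v0 := overlap_v QB; have e01 := overlap_eps QB.
have mU : measurable (\bigcup_k B k).
  by apply: fin_bigcup_measurable => //; exact: finite_finset.
have : \sum_(k < n) 1 * m (B k `\` Q) <= \sum_(i < 1) 1 * m (\bigcup_k B k).
  apply: (@sum_measure_le _ _ _ mu _ _ (fun=> 1) (fun=> 1) _ (fun=> \bigcup_k B k)) => //.
    by move=> k; exact: measurableD.
  move=> x; rewrite big_ord1 mul1r.
  under eq_bigr do rewrite mul1r.
  have [[k [Bkx Qx]]|h] := pselect (exists k, B k x /\ ~ Q x).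
    rewrite (bigD1 k)//= big1 ?addr0.
      by rewrite !indicE !mem_set//; exists k.
    move=> j jk; rewrite indicE memNset// => -[Bjx _]; apply: Qx.
    exact: (overlap_sub QB jk Bjx Bkx).
  rewrite big1// => k _; rewrite indicE memNset// => -[Bkx Qx].
  by apply: h; exists k.
rewrite big_ord1 mul1r; apply: le_trans.
have -> : \sum_(k < n) 1 * m (B k `\` Q) = n%:R * (v - eps * v).
  rewrite (eq_bigr (fun=> v - eps * v)).
    by rewrite sumr_const card_ord mulr_natl.
  move=> k _; have mI : measurable (B k `&` Q) by exact: measurableI.
  have -> : m (B k `\` Q) = m (B k) - m (B k `&` Q).
    rewrite -fineB ?fin_num_measure//; congr fine; apply: measureD => //.
    by rewrite ltey_eq fin_num_measure.
  by rewrite mul1r (overlap_B QB) setIC measure_overlap.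
rewrite -mulrA ler_wpM2l//; nra.
Qed.

End lower_bound.

End weak_type_lower_bound.

(** * Sharpness in the three regimes of [Bp] *)

Section weak_type_sharpness.
Context d (T : measurableType d) (R : realType) (mu : probability T R).
Implicit Type p : R.

Local Notation m A := (fine (mu A)).

Section sharpness.
Variables (p q eps v : R) (n : nat) (Q : set T) (B : 'I_n -> set T).
Hypotheses (p1 : 1 < p) (pq : p^-1 + q^-1 = 1) (n0 : (0 < n)%N).
Hypothesis QB : overlapping_family mu eps v Q B.

Let p0 : 0 < p. Proof. exact: lt_trans p1. Qed.
Let n0R : 0 < n%:R :> R. Proof. by rewrite ltr0n. Qed.

Let half_powR : 2^-1 <= 2^-1 `^ p^-1 :> R.
Proof.
apply: ger1_powR; first by apply/andP; split; lra.
by rewrite invf_le1// ltW.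
Qed.

(** One member tested on its own indicator, with alpha = 1; this serves the regime where [Bp] is
    1. *)
Lemma weak_type_norm_ge_half : ((2^-1)%:E <= weak_type_norm mu p (range B))%E.
Proof.
have v0 := overlap_v QB; have Bv := overlap_B QB; have mB := overlap_mB QB.
pose k0 : 'I_n := Ordinal n0.
apply: le_trans (@weak_type_norm_ge _ _ _ mu p v 1 v n B (B k0) [set k0]%SET
  p0 v0 mB Bv (mB k0) _ ltr01 _ _).
- by rewrite Bv /= divff ?gt_eqF// powR1 mulr1 mul1r.
- by rewrite Bv.
- by move=> k; rewrite inE => /eqP ->; rewrite setIid mul1r Bv.
- rewrite (ltW v0) /= (_ : \bigcup_(_ in _) _ = B k0) ?Bv//.
  apply/seteqP; split => x; first by move=> [k /=]; rewrite inE => /eqP ->.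
  by move=> Bx; exists k0 => //=; rewrite inE.
Qed.

Let full_union :
  0 <= n%:R * v / 2 <= m (\bigcup_(k in [set` [set: 'I_n]%SET]) B k).
Proof.
have v0 := overlap_v QB.
apply/andP; split; first by rewrite divr_ge0// mulr_ge0// ltW.
apply: le_trans (measure_overlap_union QB) _.
rewrite le_eqVlt; apply/orP; left; apply/eqP; congr (m _).
by apply/seteqP; split => x [k _ Bkx]; exists k => //=; rewrite inE.
Qed.

(** Test function: the indicator of Q, with alpha = eps. The 4 collects the halved level and the
    bound 2^(-1/p) >= 1/2 for the halved union. *)
Lemma weak_type_norm_ge_base :
  ((eps * n%:R `^ p^-1 / 4)%:E <= weak_type_norm mu p (range B))%E.
Proof.
have v0 := overlap_v QB; have eps01 := overlap_eps QB.
have [mB mQ] := (overlap_mB QB, overlap_mQ QB).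
have eps0 : 0 < eps by lra.
apply: le_trans (@weak_type_norm_ge _ _ _ mu p v eps (n%:R * v / 2) n B Q [set: 'I_n]%SET
  p0 v0 mB (overlap_B QB) mQ _ eps0 _ full_union).
- rewrite (measure_overlap_base QB) lee_fin.
  have -> : n%:R * v / 2 / v = n%:R * 2^-1 by field; rewrite gt_eqF.
  rewrite powRM// -!mulrA ler_wpM2l ?(ltW eps0)//.
  have := powR_ge0 n%:R p^-1; set y := n%:R `^ _ => y0.
  by move: half_powR; set z := _ `^ _; nra.
- by rewrite (measure_overlap_base QB).
- by move=> k _; rewrite (measure_overlap QB).
Qed.

(** Let G be the part of Q where the count is r, and M the probability of that event. By symmetry
    each [B k] contains the proportion r/n of G, so alpha = r z with z = M/n. The union has measure
    at least 1/(2 z) times that of G, and z (1/z)^(1/p) = z^(1/q). *)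
Lemma weak_type_norm_ge_binomial r : (0 < r <= n)%N ->
  ((r%:R / 4 * ('C(n, r)%:R * (eps ^+ r * (1 - eps) ^+ (n - r)) / n%:R) `^ q^-1)%:E
   <= weak_type_norm mu p (range B))%E.
Proof.
case: r => // r /= rn.
have v0 := overlap_v QB; have eps01 := overlap_eps QB.
have [mB mQ] := (overlap_mB QB, overlap_mQ QB).
have eps0 : 0 < eps by lra.
set w := _ * (1 - eps) ^+ _; have w0 : 0 < w by rewrite mulr_gt0 ?exprn_gt0//; lra.
set M := _ * w; have M0 : 0 < M by rewrite mulr_gt0// ltr0n bin_gt0.
pose P := [pred J : {set 'I_n} | #|J| == r.+1].
pose G := Q `&` [set x | P (pattern B x)].
have wJ (J : {set 'I_n}) : P J -> weight eps J = w by move=> /eqP h; rewrite weightE h.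
have mG : m G = v * M.
  rewrite (measure_pattern_pred QB) (eq_bigr (fun=> w) wJ) sumr_const /M.
  have := card_draws 'I_n r.+1; rewrite card_ord => <-.
  rewrite -[w *+ _]mulr_natl; congr (_ * (_%:R * _)).
  by apply: eq_card => J; rewrite !inE.
have GB k : m (G `&` B k) = v * ('C(n.-1, r)%:R * w).
  have := measure_pattern_pred QB [pred J | P J & k \in J].
  have -> : Q `&` [set x | [pred J | P J & k \in J] (pattern B x)] = G `&` B k.
    apply/seteqP; split => x /=.
      by move=> [Qx /andP[Px]]; rewrite inE inE.
    by move=> [[Qx Px] Bkx]; split => //; apply/andP; split => //; rewrite inE mem_set.
  move=> ->; rewrite (eq_bigr (fun=> w)); last by move=> J /andP[/wJ].
  rewrite sumr_const -(card_draws_mem r k) -[w *+ _]mulr_natl.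
  by congr (_ * (_%:R * _)); apply: eq_card => J; rewrite !inE.
pose z := M / n%:R; have z0 : 0 < z by rewrite divr_gt0.
have zE : r.+1%:R * z = 'C(n.-1, r)%:R * w.
  have h : n%:R * 'C(n.-1, r)%:R = r.+1%:R * 'C(n, r.+1)%:R :> R.
    by rewrite -!natrM -[in LHS](prednK n0) mul_bin_diag prednK.
  by rewrite /z /M !mulrA -h; field; rewrite gt_eqF.
have a0 : 0 < r.+1%:R * z by rewrite mulr_gt0// ltr0n.
apply: le_trans (@weak_type_norm_ge _ _ _ mu p v (r.+1%:R * z) (n%:R * v / 2) n B G
  [set: 'I_n]%SET p0 v0 mB (overlap_B QB) (measurable_pattern_pred QB P) _ a0 _
  full_union).
- rewrite mG lee_fin -/z.
  have -> : n%:R * v / 2 / (v * M) = 2^-1 * z^-1.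
    by rewrite /z; field; rewrite !gt_eqF.
  rewrite [(2^-1 * _) `^ _]powRM ?invr_ge0 ?(ltW z0)//.
  have -> : z `^ q^-1 = z * z^-1 `^ p^-1.
    have -> : q^-1 = 1 + -1 * p^-1 by move: pq; lra.
    rewrite powRD ?powRr1 ?(ltW z0)//; last by rewrite (gt_eqF z0) implybT.
    by rewrite powRrM powR_inv1// ltW.
  have := powR_ge0 z^-1 p^-1; set y := z^-1 `^ _ => y0.
  have ry : 0 <= r.+1%:R * z * y by rewrite mulr_ge0// ltW.
  move: half_powR; set h := _ `^ _ => h2.
  have -> : r.+1%:R / 4 * (z * y) = r.+1%:R * z * y / 4 by ring.
  have -> : r.+1%:R * z / 2 * (h * y) = r.+1%:R * z * y * (h / 2) by ring.
  by rewrite ler_wpM2l//; lra.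
- by rewrite mG mulr_gt0.
- by move=> k _; rewrite GB zE mulrC.
Qed.

End sharpness.

(** The parameters depend on p and A only, not on the family. The 8 is the 4 of
    [weak_type_norm_ge_binomial] times the 2 in [Bp p A] <= 2 r. *)
Lemma weak_type_norm_sharp (p A : R) : 1 < p -> 0 < A ->
  exists (eps : R) (n : nat),
    [/\ 0 < eps <= 2^-1, (1 <= n)%N, eps * n%:R `^ p^-1 = A &
        forall v Q (B : 'I_n -> set T), overlapping_family mu eps v Q B ->
        ((expR (- (3 + 2 * expR 1)) / 8 * Bp p A)%:E <=
         weak_type_norm mu p (range B))%E].
Proof.
move=> p1 A0; pose q := p / (p - 1).
have pq : p^-1 + q^-1 = 1 := conjugate_inv p1.
have q1 : 1 < q := conjugate_gt1 p1.
have p0 := lt_trans ltr01 p1; have q0 := lt_trans ltr01 q1.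
have e2 := expR1_ge2 (R := R); have c0 := expR_gt0 (- (3 + 2 * expR 1) : R).
have c1 : expR (- (3 + 2 * expR 1)) <= 1 :> R by rewrite -[leRHS]expR0 ler_expR; lra.
have [/andP[qA Aq]|extreme] := boolP ((q * expR (- q) <= A) && (A <= q * expR (- 1))).
  have [n [r [/andP[r1 rn] e12 qr nq mass]]] := binomial_mass_lower_bound p1 A0 qA Aq.
  have n0 : (0 < n)%N by exact: leq_trans rn.
  have np : 0 < n%:R `^ p^-1 :> R by rewrite powR_gt0// ltr0n.
  exists (A / n%:R `^ p^-1), n; split => //.
  - by rewrite divr_gt0.
  - by rewrite divfK ?gt_eqF.
  move=> v Q B QB.
  apply: le_trans (weak_type_norm_ge_binomial p1 pq n0 QB (r := r) _); last by rewrite r1.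
  rewrite lee_fin; set M := _ * (_ * _) in mass *.
  have M0 : 0 <= M by rewrite (le_trans _ mass)// expR_ge0.
  have B2r : Bp p A <= 2 * r%:R.
    rewrite /Bp -/q Aq; case: ifPn => _; last exact: qr.
    have : 1 <= r%:R :> R by rewrite ler1n.
    lra.
  (* The power 1/q of the mass is at least e^-(1 + 2 e), and dividing by n^(1/q) <= e^2 costs the
     remaining 2 in the exponent. *)
  have h : expR (- (3 + 2 * expR 1)) <= (M / n%:R) `^ q^-1.
    have h2 : expR (- (3 + 2 * expR 1)) = expR (- (1 + 2 * expR 1) * q) `^ q^-1 / expR 2.
      by rewrite -expRM mulfK ?gt_eqF// -expRN -expRD; congr expR; ring.
    rewrite h2 ler_pdivrMr ?expR_gt0//.
    apply: (@le_trans _ _ ((M / n%:R) `^ q^-1 * n%:R `^ q^-1)); last first.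
      by rewrite ler_wpM2l ?powR_ge0.
    rewrite -powRM ?divr_ge0// divfK ?gt_eqF ?ltr0n//.
    by apply: ge0_ler_powR; rewrite ?nnegrE ?expR_ge0 ?invr_ge0 ?(ltW q0).
  have r0 : 0 <= r%:R :> R by [].
  have h1 := ler_wpM2r r0 h.
  have h2 := ler_wpM2l (ltW c0) B2r.
  lra.
(* In the two extreme regimes n only has to be so large that eps = A/n^(1/p) is at most 1/2. *)
pose n := (Num.truncn ((2 * A) `^ p)).+1.
have nA : 2 * A <= n%:R `^ p^-1.
  have /andP[_ h] : (Num.truncn ((2 * A) `^ p))%:R <= (2 * A) `^ p < n%:R.
    by apply: truncn_itv; exact: powR_ge0.
  have -> : 2 * A = ((2 * A) `^ p) `^ p^-1.
    by rewrite -powRrM mulfV ?gt_eqF// powRr1//; lra.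
  by apply: ge0_ler_powR; rewrite ?nnegrE ?powR_ge0 ?invr_ge0 ?(ltW p0) ?(ltW h).
have np : 0 < n%:R `^ p^-1 :> R by rewrite powR_gt0.
exists (A / n%:R `^ p^-1), n; split => //.
- by rewrite divr_gt0//= ler_pdivrMr//; lra.
- by rewrite divfK ?gt_eqF.
move=> v Q B QB; move: extreme; rewrite negb_and -!ltNge => /orP[Aq|qA].
  apply: le_trans (weak_type_norm_ge_half p1 (ltn0Sn _) QB).
  by rewrite lee_fin /Bp -/q (ltW Aq) mulr1; lra.
apply: le_trans (weak_type_norm_ge_base p1 QB).
rewrite lee_fin divfK ?gt_eqF// Bp_gt//.
have : expR (- (3 + 2 * expR 1)) * expR 1 <= 1 :> R.
  by rewrite -expRD -[leRHS]expR0 ler_expR; lra.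
nra.
Qed.

End weak_type_sharpness.

(** * Haar measure in coordinates *)

(** Cauchy's functional equation on [0, 1]: additivity and nonnegativity give monotonicity, and
    comparing x with floor (n x)/n bounds the defect by F 1/n for every n > 0. *)
Lemma additive_ge0_linear (R : realType) (F : R -> R) :
  (forall a h, 0 <= a -> 0 <= h -> a + h <= 1 -> F (a + h) = F a + F h) ->
  (forall x, 0 <= x <= 1 -> 0 <= F x) ->
  forall x, 0 <= x <= 1 -> F x = x * F 1.
Proof.
move=> FD F0 x /andP[x0 x1].
have FM k y : 0 <= y -> k%:R * y <= 1 -> F (k%:R * y) = k%:R * F y.
  move=> y0; elim: k => [_|k IHk].
    by rewrite !mul0r; have := FD 0 0; rewrite addr0 => /(_ _ _ _); lra.
  rewrite -natr1 !mulrDl !mul1r => h.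
  have ky : 0 <= k%:R * y by rewrite mulr_ge0.
  by rewrite FD// IHk//; lra.
have F1 : 0 <= F 1 by apply: F0; rewrite lexx ler01.
have step n : (0 < n)%N -> `|F x - x * F 1| * n%:R <= F 1.
  move=> n0; have n0R : 0 < n%:R :> R by rewrite ltr0n.
  have Fn : F 1 = n%:R * F n%:R^-1.
    by rewrite -FM ?divff ?gt_eqF// invr_ge0 ltW.
  pose k := Num.truncn (n%:R * x).
  have /andP[kx xk] : k%:R <= n%:R * x < k.+1%:R.
    by apply: truncn_itv; rewrite mulr_ge0.
  pose e := (n%:R^-1 : R); have e0 : 0 <= e by rewrite invr_ge0.
  have ne : n%:R * e = 1 by rewrite divff ?gt_eqF.
  have n1 : 1 <= n%:R :> R by rewrite ler1n.
  have kex : k%:R * e <= x.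
    by rewrite ler_pdivrMr// mulrC.
  have xke : x - k%:R * e <= e.
    have : x < (k%:R + 1) * e by rewrite ltr_pdivlMr// mulrC natr1.
    lra.
  have k0 : 0 <= k%:R * e by rewrite mulr_ge0.
  have Fx : F x = k%:R * F e + F (x - k%:R * e).
    rewrite -FM//; last lra.
    by rewrite -FD ?[_ + (_ - _)]addrC ?subrK//; lra.
  have e1 : e <= 1 by rewrite invf_le1.
  have r0 : 0 <= F (x - k%:R * e) by apply: F0; lra.
  have r1 : F (x - k%:R * e) <= F e.
    have := FD (e - (x - k%:R * e)) (x - k%:R * e); rewrite subrK => ->; try lra.
    by rewrite lerDr; apply: F0; lra.
  have Fe : 0 <= F e by apply: F0; lra.
  rewrite -(gtr0_norm n0R) -normrM mulrBl ler_norml.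
  rewrite -natr1 in xk; rewrite -/e in Fn.
  have h1 := ler_wpM2r F1 kx; have h2 := ler_wpM2r F1 (ltW xk).
  have h3 : F x * n%:R = k%:R * F 1 + n%:R * F (x - k%:R * e).
    by rewrite Fx Fn; ring.
  have h4 : n%:R * F (x - k%:R * e) <= F 1 by rewrite Fn ler_pM2l.
  have h5 : 0 <= n%:R * F (x - k%:R * e) by rewrite mulr_ge0.
  rewrite h3; lra.
apply/eqP; rewrite -subr_eq0 -normr_eq0; apply/negPn/negP => neq.
have pos : 0 < `|F x - x * F 1| by rewrite lt_def neq normr_ge0.
have := step (Num.truncn (F 1 / `|F x - x * F 1|)).+1 (ltn0Sn _).
have /andP[_] := truncn_itv (divr_ge0 F1 (ltW pos)).
by rewrite ltr_pdivrMr// mulrC => h1 h2; have := lt_le_trans h1 h2; rewrite ltxx.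
Qed.

Section torus.
Context {R : realType}.
Implicit Types (z w : torus R) (x y t : torusw R).

Lemma torus_rep_class (r : R) : 0 <= r < 1 -> torus_rep (torus_class r) = r.
Proof. by move=> r01; rewrite /= (@floor_def _ _ 0) ?subr0// add0r. Qed.

Lemma torus_repD z w : torus_rep (z + w) =
  if torus_rep z + torus_rep w < 1 then torus_rep z + torus_rep w
  else torus_rep z + torus_rep w - 1.
Proof.
have := torus_repP z; have := torus_repP w => w01 z01.
have -> : z + w = torus_class (torus_rep z + torus_rep w) by [].
case: ltP => h; first by rewrite torus_rep_class//; lra.
rewrite -(torus_classDint _ (- 1)) mulrN1z torus_rep_class//; lra.
Qed.

Lemma torus_repB z w : torus_rep (z - w) =
  if torus_rep w <= torus_rep z then torus_rep z - torus_rep w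
  else torus_rep z - torus_rep w + 1.
Proof.
have := torus_repD (z - w) w; rewrite subrK.
have := torus_repP z; have := torus_repP w; have := torus_repP (z - w).
move=> zw01 w01 z01; case: ltP => _ zE; case: leP; lra.
Qed.

Lemma torusw_subE x t i : (x - t) i = x i - t i.
Proof. by []. Qed.

Lemma translateE t (A : set (torusw R)) : translate t A = [set x | A (x - t)].
Proof.
apply/seteqP; split => x /=; first by move=> [y Ay <-]; rewrite addrC addKr.
by move=> Ax; exists (x - t); rewrite // addrC subrK.
Qed.

Lemma measurable_coord k (X : set R) : measurable X ->
  measurable [set x : torusw R | X (torus_rep (x k))].
Proof. by move=> mX; apply: sub_sigma_algebra; exists k, X. Qed.

(** Coordinate k of x - t is a translate of that of x on either side of the break at c, so preimages
    of cylinders are cylinders over measurable sets. *)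
Lemma measurable_translate t (A : set (torusw R)) :
  measurable A -> measurable (translate t A).
Proof.
move=> mA; rewrite translateE.
suff : measurable_fun setT (fun x : torusw R => x - t).
  by move=> /(_ measurableT _ mA); rewrite setTI.
apply: (@measurability _ _ _ _ _ _ (@torusw_cylinder R)) => //.
move=> _ [_ [k [X [mX ->]]] <-]; rewrite setTI.
pose c := torus_rep (t k).
have -> : (fun x : torusw R => x - t) @^-1` [set x | X (torus_rep (x k))] =
    [set x : torusw R | ([set r | c <= r /\ X (r - c)] `|`
                         [set r | r < c /\ X (r - c + 1)]) (torus_rep (x k))].
  have E x : torus_rep ((x - t) k) = _ := torus_repB (x k) (t k).
  apply/seteqP; split => x h.
    have {h} : X (torus_rep ((x - t) k)) by exact: h.
    by rewrite E -/c; case: leP; [left|right].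
  suff : X (torus_rep ((x - t) k)) by [].
  by rewrite E -/c; case: h => -[]; case: leP => // + /lt_geF ->.
apply: measurable_coord; apply: measurableU.
  have -> : [set r | c <= r /\ X (r - c)] = `[c, +oo[ `&` (fun r => r - c) @^-1` X.
    by apply/seteqP; split => r /=; rewrite in_itv/= andbT.
  apply: measurableI => //; rewrite -[X in measurable X]setTI.
  by apply: measurable_funB.
have -> : [set r | r < c /\ X (r - c + 1)] =
    `]-oo, c[ `&` (fun r => r - c + 1) @^-1` X.
  by apply/seteqP; split => r /=; rewrite in_itv.
apply: measurableI => //; rewrite -[X in measurable X]setTI.
by apply: measurable_funD => //; exact: measurable_funB.
Qed.

(** Functional independence: membership is insensitive to coordinate k. Stochastic independence from
    that coordinate is derived from it by invariance. *)
Definition independent_of k (A : set (torusw R)) :=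
  forall x y, (forall i, i != k -> x i = y i) -> A x -> A y.

Section haar.
Variable mu : probability (torusw R) R.
Hypothesis mu_haar : haar mu.

Local Notation m A := (fine (mu A)).

(** A translation moving only coordinate k preserves A, so it maps the intersection of A and D onto
    that of A and the translate of D. *)
Lemma haar_translateI k t (A D : set (torusw R)) :
  measurable A -> measurable D -> independent_of k A ->
  (forall i, i != k -> t i = 0) -> m (A `&` translate t D) = m (A `&` D).
Proof.
move=> mA mD kA t0; congr fine.
have -> : A `&` translate t D = translate t (A `&` D).
  rewrite !translateE; apply/seteqP; split => x [Ax Dx]; split => //.
    by apply: kA Ax => i /t0 ti; rewrite torusw_subE ti subr0.
  by apply: kA Ax => i /t0 ti; rewrite torusw_subE ti subr0.
by rewrite mu_haar//; exact: measurableI.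
Qed.

(** Invariance makes h |-> m (A and x_k < h) additive on [0, 1], hence linear by
    [additive_ge0_linear]. This gives half-open intervals; the left endpoint is null, being inside
    intervals of arbitrarily small measure. *)
Lemma haar_coord_itv k (A : set (torusw R)) (a b : R) :
  measurable A -> independent_of k A -> 0 <= a -> a <= b -> b <= 1 ->
  m (A `&` [set x | `]a, b[%classic (torus_rep (x k))]) = (b - a) * m A.
Proof.
move=> mA kA a0 ab b1.
pose F h := m (A `&` [set x | `]-oo, h[%classic (torus_rep (x k))]).
have mI (i : interval R) : measurable (A `&` [set x | [set` i] (torus_rep (x k))]).
  by apply: measurableI => //; exact: measurable_coord.
have mD D1 D2 D : measurable D1 -> measurable D2 -> D = D1 `|` D2 ->
    (forall x, D1 x -> ~ D2 x) -> m D = m D1 + m D2.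
  move=> mD1 mD2 -> D12; rewrite -fineD ?fin_num_measure//; congr fine.
  by apply: measureU => //; apply/seteqP; split => x // [/D12].
have shift c h : 0 <= c -> 0 <= h -> c + h <= 1 ->
    m (A `&` [set x | `[c, c + h[%classic (torus_rep (x k))]) = F h.
  (* The case h = 0 is separate since it allows c = 1, whose class has representative 0. *)
  move=> c0 h0 ch; rewrite /F; have [h00|hp] := eqVneq h 0.
    rewrite h00 addr0; congr (m (A `&` _)); apply/seteqP; split => x /=.
      by rewrite in_itv/= => ?; lra.
    by have := torus_repP (x k); rewrite in_itv/= => ?; lra.
  pose t : torusw R := fun i => if i == k then torus_class c else 0.
  have c01 : 0 <= c < 1 by move: hp; rewrite neq_lt; lra.
  rewrite -[RHS](@haar_translateI k t)//; last 2 first.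
  - exact: measurable_coord.
  - by move=> i /negbTE; rewrite /t => ->.
  have E x : torus_rep ((x - t) k) = _ := torus_repB (x k) (t k).
  have tk : torus_rep (t k) = c by rewrite /t eqxx torus_rep_class.
  congr (m (A `&` _)); rewrite translateE; apply/seteqP; split => x xh.
    suff : `]-oo, h[%classic (torus_rep ((x - t) k)) by [].
    move: (torus_rep ((x - t) k)) (E x) xh => r ->; rewrite tk /= !in_itv/=.
    by case: ifP; lra.
  have {xh} : `]-oo, h[%classic (torus_rep ((x - t) k)) by exact: xh.
  have := torus_repP (x k).
  move: (torus_rep ((x - t) k)) (E x) => r ->; rewrite tk /= !in_itv/=.
  by case: ifP; lra.
have FD c h : 0 <= c -> 0 <= h -> c + h <= 1 -> F (c + h) = F c + F h.
  move=> c0 h0 ch; rewrite -(shift c h)//; apply: mD => //.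
    apply/seteqP; split => x /=.
      move=> [Ax]; rewrite !in_itv/= => xc.
      by have [?|?] := ltP (torus_rep (x k)) c; [left|right]; split => //; apply/andP.
    by rewrite !in_itv/=; move=> [[Ax xc]|[Ax /andP[cx xc]]]; split => //; lra.
  by move=> x /=; rewrite !in_itv/= => -[_ xc] [_ /andP[cx _]]; lra.
have Flin := additive_ge0_linear FD (fun r _ => fine_ge0 (measure_ge0 mu _)).
have F1 : F 1 = m A.
  congr (m _); apply/seteqP; split => x /=; first by case.
  by move=> Ax; split => //; rewrite in_itv/=; have /andP[] := torus_repP (x k).
rewrite {}F1 in Flin.
have [->|neq] := eqVneq a b.
  rewrite subrr mul0r (_ : _ `&` _ = set0) ?measure0//.
  by apply/seteqP; split => x //= [_]; rewrite in_itv/=; lra.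
have {}ab : a < b by rewrite lt_neqAle neq.
have co h : 0 <= h -> a + h <= 1 ->
    m (A `&` [set x | `[a, a + h[%classic (torus_rep (x k))]) = h * m A.
  by move=> h0 ah; rewrite shift// Flin//; lra.
have pt : m (A `&` [set x | `[a, a]%classic (torus_rep (x k))]) = 0.
  apply: le_anti; rewrite fine_ge0// andbT; apply/ler_addgt0Pl => e e0.
  rewrite addr0.
  pose h := Num.min e (1 - a).
  have he : h <= e by rewrite ge_min lexx.
  have h1 : h <= 1 - a by rewrite ge_min lexx orbT.
  have h0 : 0 < h by rewrite lt_min e0; lra.
  apply: (@le_trans _ _ (h * m A)).
    rewrite -co; [|lra|lra].
    rewrite fine_le ?fin_num_measure//; apply: le_measure; rewrite ?inE//.
    by move=> x [Ax] /=; rewrite !in_itv/= => xa; split => //; lra.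
  have A1 : m A <= 1.
    by rewrite -lee_fin fineK ?fin_num_measure// probability_le1.
  have A0 : 0 <= m A by rewrite fine_ge0.
  nra.
have := co (b - a); rewrite [a + _]addrC subrK => <-; try lra.
rewrite -[LHS]add0r -pt; apply/esym/mD => //.
  apply/seteqP; split => x /=.
    move=> [Ax]; rewrite !in_itv/= => /andP[]; rewrite le_eqVlt => /orP[/eqP xa|xa] xb.
      by left; split => //; lra.
    by right; split => //; lra.
  by rewrite !in_itv/=; move=> [[Ax xc]|[Ax /andP[cx xc]]]; split => //; lra.
by move=> x /=; rewrite !in_itv/= => -[_ xc] [_ /andP[cx _]]; lra.
Qed.

End haar.

End torus.

(** Positive exponents keep every nonfree side at most 1/2, which excludes wrap-around in
    [shifted_box]. *)
Lemma exponents_pos (e : nat) i : (0 < e)%N -> (i < size (exponents e))%N ->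
  (0 < nth 0 (exponents e) i)%N.
Proof.
move=> e0 ie; have [n /andP[ne en]] : exists n, (n ^ 2 < e <= n.+1 ^ 2)%N.
  have h : exists n, (e <= n.+1 ^ 2)%N.
    by exists e; apply: leq_trans (leqnSn _) _; rewrite expnS leq_pmulr// expn_gt0.
  exists (ex_minn h); case: ex_minnP => -[|n] en minn; rewrite en andbT// ltnNge.
  by apply/negP => /minn; rewrite ltnn.
have : nth 0%N (exponents e) i \in exponents e by exact: mem_nth.
rewrite /exponents (exponents_root ne en); case: eqP => [_|n0].
  by rewrite inE => /eqP ->.
case: ifP => _.
  by rewrite mem_rcons inE mem_nseq => /orP[/eqP ->|/andP[_ /eqP ->]]; lia.
by rewrite mem_cat !mem_nseq => /orP[] /andP[_ /eqP ->]; lia.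
Qed.

Lemma size_exponents_gt n : (n <= size (exponents (n.+1 ^ 2 + 1)))%N.
Proof. by rewrite exponents_low// size_rcons size_nseq leqW. Qed.

(** * Measures of product sets *)

Section torus.
Context {R : realType}.
Implicit Types (z w : torus R) (x y t : torusw R) (X : nat -> set R).

Definition box N X := [set x : torusw R | forall i, (i < N)%N -> X i (torus_rep (x i))].

Lemma boxS N X : box N.+1 X = box N X `&` [set x | X N (torus_rep (x N))].
Proof.
apply/seteqP; split => x /=.
  by move=> h; split => [i iN|]; apply: h => //; exact: ltnW.
by move=> [h hN] i; rewrite ltnS leq_eqVlt => /orP[/eqP ->//|]; exact: h.
Qed.

Lemma box0 X : box 0 X = setT.
Proof. exact/seteqP. Qed.

Lemma measurable_box N X : (forall i, measurable (X i)) -> measurable (box N X).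
Proof.
move=> mX; elim: N => [|N IHN]; first by rewrite box0.
by rewrite boxS; apply: measurableI => //; exact: measurable_coord.
Qed.

Lemma independent_of_box k N X : (N <= k)%N -> independent_of k (box N X).
Proof.
move=> Nk x y xy xX i iN; rewrite -xy; first exact: xX.
by rewrite neq_ltn (leq_trans iN Nk).
Qed.

Section haar.
Variable mu : probability (torusw R) R.
Hypothesis mu_haar : haar mu.

Local Notation m A := (fine (mu A)).

(** Quantifying over every A insensitive to coordinate k makes the property stable under proper
    differences and lets coordinates be added one at a time in [measure_box]. *)
Definition uniform_on (beta : R) (Y : set R) :=
  measurable Y /\
  forall k (A : set (torusw R)), measurable A -> independent_of k A ->
    m (A `&` [set x | Y (torus_rep (x k))]) = beta * m A.

Lemma uniform_on_itv (a b : R) : 0 <= a -> a <= b -> b <= 1 ->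
  uniform_on (b - a) `]a, b[%classic.
Proof. by move=> *; split => // k A mA kA; exact: haar_coord_itv. Qed.

Lemma uniform_onD (b c : R) (Y Z : set R) : Z `<=` Y ->
  uniform_on b Y -> uniform_on c Z -> uniform_on (b - c) (Y `\` Z).
Proof.
move=> ZY [mY bY] [mZ cZ]; split => [|k A mA kA]; first exact: measurableD.
rewrite mulrBl -(bY k)// -(cZ k)//; set D := _ `&` _.
set D1 := A `&` _; set D2 := A `&` _.
have mD1 : measurable D1 by apply: measurableI => //; exact: measurable_coord.
have mD2 : measurable D2 by apply: measurableI => //; exact: measurable_coord.
have D21 : D1 `&` D2 = D2.
  apply/seteqP; split => x /=; first by case.
  by move=> [Ax Zx]; split => //; split => //; exact: ZY.
have -> : D = D1 `\` D2.
  apply/seteqP; split => x /=; first by move=> [Ax [Yx nZx]]; split => // -[].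
  by move=> [[Ax Yx] nZx]; split => //; split => // Zx; apply: nZx.
rewrite -fineB ?fin_num_measure//; congr fine; rewrite -[in RHS]D21.
by apply: measureD => //; rewrite ltey_eq fin_num_measure.
Qed.

Lemma measure_box N X (beta : nat -> R) :
  (forall i, uniform_on (beta i) (X i)) -> m (box N X) = \prod_(i < N) beta i.
Proof.
move=> uX; elim: N => [|N IHN]; first by rewrite box0 big_ord0 probability_setT.
rewrite boxS big_ord_recr /= -IHN mulrC; apply: (uX N).2; last exact: independent_of_box.
by apply: measurable_box => i; case: (uX i).
Qed.

End haar.
End torus.

(** * Configurations *)

Section configuration.
Context {R : realType}.
Implicit Types (z w : torus R) (x y t : torusw R).
Variables (e : nat) (t : torusw R) (eps : R) (n : nat).
Hypotheses (e0 : (1 <= e)%N) (Ht : H e t) (eps01 : 0 < eps <= 2^-1).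
Hypothesis ne : (n <= size (exponents e))%N.

Let N := size (exponents e).
Let ell i : R := 2 ^- nth 0%N (exponents e) i.
Let Q := translate t (@V R e).

Let ell_gt0 i : 0 < ell i.
Proof. by rewrite invr_gt0 exprn_gt0. Qed.

Let ell_le_half i : (i < N)%N -> ell i <= 2^-1.
Proof.
move=> iN; rewrite lef_pV2 ?posrE ?exprn_gt0// -[leLHS]expr1.
by rewrite ler_weXn2l ?ler1n//; exact: exponents_pos.
Qed.

Let ell_le1 i : ell i <= 1.
Proof. by rewrite invf_le1 ?exprn_gt0// exprn_ege1// ler1n. Qed.

Let VE : @V R e = box N (fun i => `]0, ell i[%classic).
Proof. by apply/seteqP; split => x h i iN; have := h i iN; rewrite /= in_itv. Qed.

(** As t is in [H e], its coordinate is l 2^(-a) with l + 1 <= 2^a: the translated side stays inside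
    [0, 1] without wrapping around. *)
Let projection_length k : (k < N)%N -> torus_length [set x k | x in Q] = ell k.
Proof.
move=> kN; have := Ht k; rewrite kN -/(ell k) => -[l la tk].
have lk := ell_gt0 k.
have tk1 : torus_rep (t k) + ell k <= 1.
  rewrite tk -[X in _ + X]mul1r -mulrDl ler_pdivrMr ?exprn_gt0// mul1r natr1.
  by rewrite -natrX ler_nat.
have tk0 : 0 <= torus_rep (t k) by case/andP: (torus_repP (t k)).
rewrite /torus_length.
have -> : [set torus_rep z | z in [set x k | x in Q]] =
    `]torus_rep (t k), torus_rep (t k) + ell k[%classic.
  apply/seteqP; split => r.
    move=> [z [x [y Vy <-] <-] <-]; have := Vy k kN.
    rewrite [(t + y) k]/(t k + y k) torus_repD -/(ell k) => yk.
    by case: ltP => ?; rewrite /= in_itv/=; lra.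
  rewrite /= in_itv/= => rk.
  (* Coordinate k realizes r; the others are midpoints, just to stay in [V e]. *)
  pose y : torusw R := fun i =>
    if i == k then torus_class (r - torus_rep (t k)) else torus_class (ell i / 2).
  have yk : torus_rep (y k) = r - torus_rep (t k).
    by rewrite /y eqxx torus_rep_class//; lra.
  exists ((t + y) k).
    exists (t + y) => //; exists y => // i iN; rewrite -/(ell i).
    have [->|ik] := eqVneq i k; first by rewrite yk; lra.
    rewrite /y (negbTE ik) torus_rep_class.
      by have := ell_gt0 i; lra.
    by have := ell_gt0 i; have := ell_le1 i; lra.
  by rewrite [(t + y) k]/(t k + y k) torus_repD yk; case: ltP; lra.
rewrite lebesgue_measure_itv/= lte_fin ltrDl lk -EFinD /=; ring.
Qed.

Let s k : R := (1 - eps) * ell k.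
Let shift_itv k : 0 < s k < ell k.
Proof.
have /andP[eps0 eps2] := eps01.
have e1 : 0 < 1 - eps by lra.
have e2 : 1 - eps < 1 by lra.
by rewrite /s mulr_gt0 ?ell_gt0//= gtr_pMl ?ell_gt0.
Qed.

Let T k := conf_shift eps Q k.

Let shift_rep k : (k < N)%N -> torus_rep (T k k) = s k.
Proof.
move=> kN; rewrite /T /conf_shift eqxx projection_length// torus_rep_class//.
by move: (shift_itv k) (ell_le1 k); rewrite -/(s k); move: (s k) (ell k) => a b; lra.
Qed.

Let shift_ne k i : i != k -> T k i = 0.
Proof. by rewrite /T /conf_shift => /negbTE ->. Qed.

(** Only coordinate k moves. If y_k < s k, then y_k - s k wraps to a value above 1 - ell k >= 1/2 >=
    ell k, outside the side; y_k = s k gives the excluded endpoint 0. *)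
Let shifted_box k y : (k < N)%N -> @V R e y ->
  @V R e (y - T k) <-> s k < torus_rep (y k) < ell k.
Proof.
move=> kN Vy; have := torus_repB (y k) (T k k); rewrite shift_rep// => yTk.
have := ell_gt0 k; have := ell_le_half kN; have := Vy k kN.
rewrite -/(ell k) => yk h2 h0;have sk := shift_itv k.
split => [VT|syk i iN].
  have := VT k kN; rewrite torusw_subE yTk -/(ell k); move: yk h2 h0 sk.
  by move: (torus_rep (y k)) (s k) (ell k) => u a b; case: (leP a u) => *; lra.
rewrite torusw_subE -/(ell i); have [ik|ik] := eqVneq i k.
  rewrite ik yTk; move: syk yk h2 h0 sk.
  by move: (torus_rep (y k)) (s k) (ell k) => u a b; case: (leP a u) => *; lra.
by rewrite shift_ne// subr0; exact: Vy.
Qed.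

Let B (k : 'I_n) := translate (T k) Q.

Let BE k x : B k x <-> @V R e (x - t - T k).
Proof. by rewrite /B /Q !translateE /= addrAC. Qed.

(** Membership in J is tested through [map val (enum J)] because [box] requires sides indexed by all
    natural numbers. *)
Let X (J : {set 'I_n}) i : set R :=
  if (i < n)%N then
    if i \in map val (enum J) then `]s i, ell i[%classic
    else `]0, ell i[%classic `\` `]s i, ell i[%classic
  else `]0, ell i[%classic.

(** Inside Q, membership in [B k] is decided by coordinate k alone, so each pattern is a translated
    box; this product form is the source of the independence. *)
Let overlap_box (J : {set 'I_n}) :
  Q `&` [set x | pattern B x = J] = translate t (box N (X J)).
Proof.
have kN (k : 'I_n) : (k < N)%N by exact: leq_trans (ltn_ord k) ne.
have inJ (k : 'I_n) : ((k : nat) \in map val (enum J)) = (k \in J).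
  by rewrite (mem_map val_inj) mem_enum.
have ooE (a b r : R) : `]a, b[%classic r = (a < r < b) :> Prop by rewrite /= in_itv.
rewrite /Q !translateE; apply/seteqP; split => x.
  move=> [Vx xJ] i iN; have xi := Vx i iN.
  rewrite /X; case: ifPn => [ni|_]; last by rewrite ooE.
  have h := shifted_box (kN (Ordinal ni)) Vx; have hB := BE (Ordinal ni) x.
  rewrite (inJ (Ordinal ni)) -xJ inE; case: ifPn.
    by rewrite ooE => /set_mem/hB/h.
  move=> /negP nB; split; rewrite ooE; first exact: xi.
  by move=> /h/hB/mem_set.
move=> xX; have Vx : @V R e (x - t).
  move=> i iN; have := xX i iN; rewrite -/(ell i) /X.
  case: ifPn => _; last by rewrite ooE.
  case: ifPn => _; last by move=> []; rewrite ooE.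
  rewrite ooE => /andP[sx ->]; rewrite andbT (lt_trans _ sx)//.
  by case/andP: (shift_itv i).
split => //; apply/setP => k; rewrite inE.
have := xX k (kN k); rewrite /X ltn_ord inJ.
have h := shifted_box (kN k) Vx; have hB := BE k x.
case: ifPn => _.
  by rewrite ooE => /h/hB/mem_set.
by move=> [_]; rewrite ooE => nsx; apply/memNset => /hB/h.
Qed.

Variable mu : probability (torusw R) R.
Hypothesis mu_haar : haar mu.

Lemma configuration_overlapping :
  overlapping_family mu eps (\prod_(i < N) ell i) Q B.
Proof.
have uI i : uniform_on mu (ell i) `]0, ell i[%classic.
  rewrite -[X in uniform_on _ X _]subr0; apply: uniform_on_itv => //.
  exact: ltW.
have uO i : uniform_on mu (eps * ell i) `]s i, ell i[%classic.
  have -> : eps * ell i = ell i - s i by rewrite /s; ring.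
  by have /andP[s0 s1] := shift_itv i; apply: uniform_on_itv => //; exact: ltW.
have uX (J : {set 'I_n}) i : uniform_on mu
    (ell i * (if (i < n)%N then
                if i \in map val (enum J) then eps else 1 - eps else 1)) (X J i).
  rewrite /X; case: ifPn => _; last by rewrite mulr1.
  case: ifPn => _; first by rewrite mulrC.
  have -> : ell i * (1 - eps) = ell i - eps * ell i by ring.
  apply: uniform_onD => // r; rewrite /= !in_itv/= => /andP[sr ->].
  by rewrite andbT (lt_trans _ sr)//; case/andP: (shift_itv i).
have mV : measurable (@V R e) by rewrite VE; apply: measurable_box => i; case: (uI i).
have mQ : measurable Q by exact: measurable_translate.
have muQ : mu Q = (\prod_(i < N) ell i)%:E.
  by rewrite mu_haar// -(measure_box N uI) VE fineK// fin_num_measure// -VE.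
split => //.
- by apply: prodr_gt0.
- by move=> k; exact: measurable_translate.
- by move=> k; rewrite mu_haar.
(* A coordinate i is unchanged by one of the two shifts: by that of k if i = j, and by that of j
   otherwise. *)
- move=> j k x jk /BE Bj /BE Bk; rewrite /Q translateE => i iN.
  have [ij|ij] := eqVneq i (j : nat).
    have ik : i != k :> nat by rewrite ij.
    by have := Bk i iN; rewrite torusw_subE shift_ne// subr0.
  by have := Bj i iN; rewrite torusw_subE shift_ne// subr0.
- move=> J; have mX : measurable (box N (X J)).
    by apply: measurable_box => i; case: (uX J i).
  rewrite overlap_box mu_haar//.
  have -> : mu (box N (X J)) = (fine (mu (box N (X J))))%:E.
    by rewrite fineK// fin_num_measure.
  congr EFin; rewrite (measure_box N (uX J)) big_split/=; congr (_ * _).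
  (* The nonfree coordinates from n on contribute the factor 1, so the product over N coordinates
     reduces to [weight] over n. *)
  rewrite -big_mkcond /= -(big_ord_widen N
    (fun i => if i \in map val (enum J) then eps else 1 - eps) ne).
  by apply: eq_bigr => k _; rewrite (mem_map val_inj) mem_enum.
Qed.

End configuration.

Lemma is_configuration_overlapping (R : realType) (mu : probability (torusw R) R)
    (eps : R) (n : nat) (S : set (set (torusw R))) :
  haar mu -> 0 < eps <= 2^-1 -> is_configuration eps n S ->
  exists (v : R) Q (B : 'I_n -> set (torusw R)),
    overlapping_family mu eps v Q B /\ S = range B.
Proof.
move=> mu_haar eps01 [e [t [e0 Ht ne ->]]].
have := configuration_overlapping e0 Ht eps01 ne mu_haar.
set Q := translate t _ => QB.
exists (\prod_(i < size (exponents e)) 2 ^- nth 0%N (exponents e) i), Q.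
exists (fun k : 'I_n => translate (conf_shift eps Q k) Q); split => //.
apply/seteqP; split => A /=; first by move=> [k /= kn <-]; exists (Ordinal kn).
by move=> [k _ <-]; exists k => //=.
Qed.

Lemma is_configuration_exists (R : realType) (eps : R) (n : nat) :
  exists S, is_configuration eps n S.
Proof.
exists (configuration_around eps n (translate 0 (@V R (n.+1 ^ 2 + 1)))).
exists (n.+1 ^ 2 + 1)%N, 0; split; [by rewrite addn1| |exact: size_exponents_gt|by []].
move=> i; case: ifP => // _; exists 0%N; first by rewrite expn_gt0.
by rewrite mul0r; apply: torus_rep_class; rewrite lexx ltr01.
Qed.

Theorem theorem1p2 (R : realType) :
  exists C c : R, [/\ 0 < C, 0 < c &
    forall mu : probability (torusw R) R, haar mu ->
    forall p : R, 1 < p ->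
      (forall (eps : R) (d : nat) (S0 : set (set (torusw R))),
         0 < eps <= 2^-1 -> (1 <= d)%N -> is_configuration eps d S0 ->
         (weak_type_norm mu p S0 <= (C * Bp p (eps * d%:R `^ p^-1))%:E)%E) /\
      (forall A : R, 0 < A ->
         exists (eps : R) (d : nat) (S0 : set (set (torusw R))),
           [/\ 0 < eps <= 2^-1, (1 <= d)%N, eps * d%:R `^ p^-1 = A,
               is_configuration eps d S0 &
               ((c * Bp p A)%:E <= weak_type_norm mu p S0)%E])].
Proof.
exists 8, (expR (- (3 + 2 * expR 1)) / 8); split.
- by [].
- by rewrite divr_gt0 ?expR_gt0.
move=> mu mu_haar p p1; split => [eps d S0 eps01 d1 confS|A A0].
  have [v [Q [B [QB ->]]]] := is_configuration_overlapping mu_haar eps01 confS.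
  exact: weak_type_norm_le QB.
have [eps [d [eps01 d1 epsA sharp]]] := weak_type_norm_sharp mu p1 A0.
have [S0 confS] := is_configuration_exists eps d.
exists eps, d, S0; split => //.
have [v [Q [B [QB ->]]]] := is_configuration_overlapping mu_haar eps01 confS.
exact: sharp QB.
Qed.
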